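(* (a) The free / Boolean Meixner class is closed under free and Boolean convolution powers, and consequently under the operation $\mathbb{B}_t$. In fact, $$\mathbb{B}_t(\varphi_{C,\{T_i\}})=\varphi_{tI+C,\{T_i\}}.$$ (b) Every one-dimensional free / Boolean Meixner distribution can be obtained from a Bernoulli distribution by the application of an appropriate $\mathbb{B}_t$.
   Context: $\mathbb{C}\langle x_1,\ldots,x_d\rangle$: polynomials in non-commuting self-adjoint variables, $x_{\vec u}=x_{u(1)}\cdots x_{u(n)}$ for a multi-index $\vec u$. A state is a unital linear functional with $\varphi[P^*]=\overline{\varphi[P]}$, $\varphi[P^*P]\ge0$. Free (equivalently, Boolean) Meixner states: let $T_1,\ldots,T_d$ be Hermitian $d\times d$ matrices and $C$ a diagonal $d^2\times d^2$ matrix, $C(e_i\otimes e_j)=C_{ij}e_i\otimes e_j$, with $I+C\ge0$ and $(T_i\otimes I)C=C(T_i\otimes I)$. The free Meixner state $\varphi_{C,\{T_i\}}$ is the unital functional (which is a state with zero means and identity covariance) determined by $\varphi[P_{\vec u}]=0$ for $\vec u\neq\emptyset$, where the $P_{\vec u}$ are defined by $P_\emptyset=1$, $x_i=P_i$, $x_iP_j=P_{(i,j)}+\sum_k(T_i)_{kj}P_k+\delta_{ij}$, and $x_iP_{(j,\vec u)}=P_{(i,j,\vec u)}+\sum_k(T_i)_{kj}P_{(k,\vec u)}+\delta_{ij}(1+C_{i,u(1)})P_{\vec u}$ for $|\vec u|\ge1$. Free Meixner states are exactly the states $\varphi_{C,\{T_i\}}$. For $d=1$, the data are $T=b\in\mathbb{R}$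 and $C=c\ge-1$. Since these states are normalized to identity covariance while $t$-th convolution powers have covariance $tI$, membership of a convolution power in the class is understood up to dilation, the dilation of $\varphi$ by $s>0$ being $x_{\vec u}\mapsto s^{|\vec u|}\varphi[x_{\vec u}]$. Boolean (resp. free) cumulant generating functions: $\eta_\varphi(\mathbf{z})=\sum_{|\vec u|\ge1}\eta_\varphi[x_{\vec u}]z_{\vec u}$ (resp. $R_\varphi$), where $\varphi[x_{\vec u}]=\sum_\pi\prod_{B\in\pi}\eta_\varphi[\prod_{i\in B}x_{u(i)}]$ over interval partitions (resp. the same with $R_\varphi$ over non-crossing partitions) of $\{1,\ldots,|\vec u|\}$. Convolution powers ($t>0$) are the unital linear functionals with $\eta_{\varphi^{\uplus t}}=t\,\eta_\varphi$ and $R_{\varphi^{\boxplus t}}=t\,R_\varphi$. The Belinschi–Nica transformation is $\mathbb{B}_t(\varphi)=\bigl(\varphi^{\boxplus(1+t)}\bigr)^{\uplus(1/(1+t))}$, $t\ge0$. Bernoulli distributions (mean zero, variance one): $\frac{1}{1+\beta^2}\delta_\beta+\frac{\beta^2}{1+\beta^2}\delta_{-1/\beta}$, $\beta\in\mathbb{R}\setminus\{0\}$.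
   Formalization: Closure under free convolution powers is stated for t ≥ 1, or for 0 < t < 1 when the power is a state; otherwise it fails (e.g. the symmetric Bernoulli law, C = −1, with t = 1/2, has a free power that is not a state and so is not in the class). *)

(* Defs.v *)
From HB Require Import structures.
From mathcomp Require Import all_boot all_order all_algebra.
From mathcomp Require Import sesquilinear spectral complex mxtens.
From mathcomp Require Import finmap monalg.
From mathcomp Require Import boolp reals.

Set Implicit Arguments.
Unset Strict Implicit.
Unset Printing Implicit Defensive.

Import Order.TTheory GRing.Theory Num.Theory.

Local Open Scope ring_scope.
Local Open Scope sesquilinear_scope.

(* The algebra of polynomials in d non-commuting variables over the complex   *)
(* numbers R[i], as the algebra of the free monoid on 'I_d.                   *)
Notation ncpoly R d := {malg R[i][{fmonom 'I_d}]}.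

Section Polynomials.
Context {R : realType} {d : nat}.
Local Notation C := R[i].
Local Notation A := (ncpoly R d).
Implicit Types (P Q : A) (u w : seq 'I_d).

Definition ncX (i : 'I_d) : A := << FMonom [:: i] >>.

Definition ncword u : A := \prod_(i <- u) ncX i.

(* The involution for which the variables are self-adjoint. *)
Definition ncadj P : A :=
  \sum_(u <- msupp P) << (P@_u)^* *g FMonom (rev u) >>.

Definition unital (phi : {scalar A}) : Prop := phi 1 = 1.

Definition is_state (phi : {scalar A}) : Prop :=
  [/\ unital phi,
      forall P, phi (ncadj P) = (phi P)^*
    & forall P, 0 <= phi (ncadj P * P)].

Lemma ncwordE u : ncword u = << FMonom u >>.
Proof.
rewrite /ncword; elim: u => [|i u IH].
  by rewrite big_nil; congr mkmalgU; apply/eqP; rewrite fmP fm1.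
rewrite big_cons IH; apply: etrans (fgmulUU _ _ _ _) _; rewrite mulr1.
by congr mkmalgU; apply/eqP; rewrite fmP fmM.
Qed.

Lemma ncword_nil : ncword [::] = 1.
Proof. by rewrite /ncword big_nil. Qed.

Lemma ncword_cons i u : ncword (i :: u) = ncX i * ncword u.
Proof. by rewrite /ncword big_cons. Qed.

Lemma ncword_rcons u i : ncword (rcons u i) = ncword u * ncX i.
Proof. by rewrite /ncword -cats1 big_cat big_seq1. Qed.

Lemma ncpolyE P : P = \sum_(u <- msupp P) P@_u *: ncword u.
Proof.
rewrite [LHS]monalgE; apply: eq_bigr => u _; rewrite ncwordE fmK.
apply/malgP => w; apply: etrans (mcoeffU _ _ _) _.
by rewrite mcoeffZ mcoeffU1 mulr_natr.
Qed.

(* {malg R[K]} is only declared as an lalgType when K is not commutative. *)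
Lemma ncmulZr (c : C) P Q : P * (c *: Q) = c *: (P * Q).
Proof.
have E (D : A) : c *: D = c%:MP * D := esym (mul_malgC c D).
have cP : P * c%:MP = c%:MP * P.
  rewrite (monalgE P) mulr_suml mulr_sumr; apply: eq_bigr => u _.
  have UU (a b : C) (k l : {fmonom 'I_d}) :
    (<< a *g k >> : A) * << b *g l >> = << a * b *g mmul k l >> := fgmulUU _ _ _ _.
  by rewrite [LHS]UU [RHS]UU mulm1 mul1m mulrC.
by rewrite (E Q) (E (P * Q)) mulrA cP -mulrA.
Qed.

Lemma eq_on_words (V : lmodType C) (s : GRing.Scale.law C V)
  (f g : {linear A -> V | s}) :
  (forall u, f (ncword u) = g (ncword u)) -> f =1 g.
Proof.
move=> fg P; rewrite (ncpolyE P) !linear_sum.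
by apply: eq_bigr => u _; rewrite !linearZ /= fg.
Qed.

Definition word_linear (V : lmodType C) (f : seq 'I_d -> V) P : V :=
  \sum_(u <- msupp P) P@_u *: f u.

Definition word_functional (f : seq 'I_d -> C) P : C :=
  \sum_(u <- msupp P) P@_u * f u.


Fact word_linear_is_linear (V : lmodType C) (f : seq 'I_d -> V) :
  linear (word_linear f).
Proof.
have E (D : {fset {fmonom 'I_d}}) P : (msupp P `<=` D)%fset ->
    word_linear f P = \sum_(u <- D) P@_u *: f u.
  move=> PD; rewrite /word_linear (big_fset_incl _ PD) //= => u _.
  by move=> /mcoeff_outdom->; rewrite scale0r.
move=> c P Q; pose D := (msupp P `|` msupp Q `|` msupp (c *: P + Q))%fset.
have D1 : (msupp (c *: P + Q) `<=` D)%fset by apply: fsubsetUr.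
have D2 : (msupp P `<=` D)%fset by rewrite fsubsetU // fsubsetUl.
have D3 : (msupp Q `<=` D)%fset by rewrite fsubsetU // fsubsetUr.
rewrite (E D _ D1) (E D _ D2) (E D _ D3).
rewrite scaler_sumr -big_split /=; apply: eq_bigr => u _.
by rewrite mcoeffD mcoeffZ scalerDl scalerA.
Qed.
HB.instance Definition _ (V : lmodType C) (f : seq 'I_d -> V) :=
  GRing.isLinear.Build C A V *:%R (word_linear f) (word_linear_is_linear f).

Fact word_functional_is_scalar (f : seq 'I_d -> C) : scalar (word_functional f).
Proof. exact: (@word_linear_is_linear C^o f). Qed.
HB.instance Definition _ (f : seq 'I_d -> C) :=
  GRing.isLinear.Build C A C *%R (word_functional f)
    (word_functional_is_scalar f).

Lemma word_linearE (V : lmodType C) (f : seq 'I_d -> V) u :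
  word_linear f (ncword u) = f u.
Proof.
by rewrite ncwordE /word_linear msuppU1 big_seq_fset1 mcoeffUU scale1r.
Qed.

Lemma word_functionalE (f : seq 'I_d -> C) u :
  word_functional f (ncword u) = f u.
Proof. exact: (@word_linearE C^o f). Qed.

End Polynomials.

Definition is_interval_partition n (pi : {set {set 'I_n}}) : bool :=
  partition pi [set: 'I_n] &&
  [forall B in pi, forall i in B, forall j in B,
     forall k : 'I_n, (i <= k <= j)%N ==> (k \in B)].

Definition is_noncrossing_partition n (pi : {set {set 'I_n}}) : bool :=
  partition pi [set: 'I_n] &&
  [forall B in pi, forall B' in pi, (B != B') ==>
     ~~ [exists i in B, exists j in B', exists k in B, exists l in B',
          [&& i < j, j < k & k < l]%N]].

Section Cumulants.
Context {R : realType} {d : nat}.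
Local Notation C := R[i].
Local Notation A := (ncpoly R d).
Implicit Types (phi psi : {scalar A}) (kappa : seq 'I_d -> C) (u : seq 'I_d).

(* The product of the letters of u at the positions in B, in increasing order *)
(* of position (enum B is increasing).                                        *)
Definition subword (u : seq 'I_d) (B : {set 'I_(size u)}) : seq 'I_d :=
  [seq tnth (in_tuple u) i | i <- enum B].

Definition partition_family := forall n, {set {set 'I_n}} -> bool.

(* Cumulants are indexed by non-empty words; the value at the empty word is   *)
(* set to 0 so that they are uniquely determined.                             *)
Definition is_cumulant (S : partition_family) phi kappa : Prop :=
  kappa [::] = 0 /\
  forall u, u != [::] ->
    phi (ncword u) =
      \sum_(pi : {set {set 'I_(size u)}} | S (size u) pi)
         \prod_(B in pi) kappa (subword B).

Definition is_convolution_power (S : partition_family) (t : R) phi psi : Prop :=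
  unital psi /\
  forall kappa, is_cumulant S phi kappa ->
    is_cumulant S psi (fun u => t%:C%C * kappa u).

Section Generic.
Variable S : partition_family.
Arguments S : clear implicits.
Hypothesis S_partition : forall n pi, S n pi -> partition pi [set: 'I_n].
Hypothesis S_top : forall n, (0 < n)%N -> S n [set [set: 'I_n]].

Lemma size_subword u (B : {set 'I_(size u)}) : size (subword B) = #|B|.
Proof. by rewrite size_map -cardE. Qed.

Lemma subwordT u : subword [set: 'I_(size u)] = u.
Proof.
rewrite /subword enum_setT -enumT.
by rewrite (map_tnth_enum (in_tuple u)).
Qed.

Lemma subword_neq_nil u (pi : {set {set 'I_(size u)}}) B :
  S (size u) pi -> B \in pi -> subword B != [::].
Proof.
move=> /S_partition/and3P[_ _ pi0] Bpi; rewrite -size_eq0 size_subword cards_eq0.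
by apply: contraNneq pi0 => <-.
Qed.

Lemma size_subword_lt u (pi : {set {set 'I_(size u)}}) B :
  S (size u) pi -> pi != [set [set: 'I_(size u)]] -> B \in pi ->
  (size (subword B) < size u)%N.
Proof.
move=> /S_partition/and3P[_ /trivIsetP triv pi0] piT Bpi.
rewrite size_subword -[X in (_ < X)%N]card_ord -cardsT proper_card //.
rewrite properT; apply: contraNneq piT => BT.
rewrite BT in Bpi; rewrite eqEsubset sub1set Bpi andbT.
apply/subsetP => B' B'pi; rewrite inE; apply/negPn/negP => B'T.
have := triv _ _ B'pi Bpi B'T; rewrite -setI_eq0 setIT => /eqP B'0.
by rewrite -B'0 B'pi in pi0.
Qed.

Lemma sum_topE (u : seq 'I_d) (F : {set 'I_(size u)} -> C) : u != [::] ->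
  \sum_(pi : {set {set 'I_(size u)}} | S (size u) pi) \prod_(B in pi) F B =
  F [set: _] +
  \sum_(pi : {set {set 'I_(size u)}} |
      S (size u) pi && (pi != [set [set: 'I_(size u)]])) \prod_(B in pi) F B.
Proof.
move=> u0; rewrite (bigD1 [set [set: 'I_(size u)]]) /=; first by rewrite big_set1.
by rewrite S_top // lt0n size_eq0.
Qed.

Fixpoint cumulant_rec (m : seq 'I_d -> C) (n : nat) (u : seq 'I_d) : C :=
  if n is n'.+1 then
    if u == [::] then 0 else
    m u - \sum_(pi : {set {set 'I_(size u)}} |
              S (size u) pi && (pi != [set [set: 'I_(size u)]]))
           \prod_(B in pi) cumulant_rec m n' (subword B)
  else 0.

Lemma cumulant_rec_stable m n n' (u : seq 'I_d) : (size u <= n)%N -> (size u <= n')%N ->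
  cumulant_rec m n u = cumulant_rec m n' u.
Proof.
elim: n n' u => [|n IH] [|n'] u; rewrite ?leqn0 ?size_eq0 //=.
- by move=> /eqP-> _.
- by move=> _ /eqP->.
move=> un un'; case: eqP => // _; congr (_ - _); apply: eq_bigr => pi /andP[Spi piT].
apply: eq_bigr => B Bpi; have lt := size_subword_lt Spi piT Bpi.
by apply: IH; rewrite -ltnS; apply: leq_trans lt _.
Qed.

Lemma cumulant_exists phi : exists kappa, is_cumulant S phi kappa.
Proof.
pose m u := phi (ncword u).
exists (fun u => cumulant_rec m (size u) u); split=> // u u0.
rewrite sum_topE // subwordT.
rewrite (@cumulant_rec_stable m _ (size u).+1 u) //= (negPf u0).
rewrite [X in _ + X](eq_bigr (fun pi : {set {set 'I_(size u)}} =>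
  \prod_(B in pi) cumulant_rec m (size u) (subword B))) ?subrK // => pi.
move=> /andP[Spi piT]; apply: eq_bigr => B Bpi; apply: cumulant_rec_stable => //.
exact: ltnW (size_subword_lt Spi piT Bpi).
Qed.

Lemma cumulant_unique phi kappa kappa' :
  is_cumulant S phi kappa -> is_cumulant S phi kappa' -> kappa =1 kappa'.
Proof.
move=> [k0 kE] [k0' kE'] u; have [n] := ubnP (size u).
elim: n u => // n IH u; rewrite ltnS => un.
have [->|u0] := eqVneq u [::]; first by rewrite k0 k0'.
have := kE' u u0; rewrite (kE u u0) !sum_topE // subwordT.
rewrite (eq_bigr (fun pi : {set {set 'I_(size u)}} => \prod_(B in pi)
    kappa' (subword B))); first by move=> /addIr.
move=> pi /andP[Spi piT]; apply: eq_bigr => B Bpi; apply: IH.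
exact: leq_trans (size_subword_lt Spi piT Bpi) un.
Qed.

Lemma convolution_power_exists t phi :
  exists psi, is_convolution_power S t phi psi.
Proof.
have [kappa kP] := cumulant_exists phi.
pose f u := if u == [::] then 1 else
  \sum_(pi : {set {set 'I_(size u)}} | S (size u) pi)
     \prod_(B in pi) (t%:C%C * kappa (subword B)).
pose psi : {scalar A} := word_functional f.
have psiE u : psi (ncword u) = f u by apply: word_functionalE.
exists psi; split; first by rewrite /unital -ncword_nil psiE.
move=> kappa' kP'; split=> [|u u0]; first by rewrite kP'.1 mulr0.
rewrite psiE /f (negPf u0); apply: eq_bigr => pi _.
by apply: eq_bigr => B _; rewrite (cumulant_unique kP kP').
Qed.

Lemma convolution_power_unique t phi psi psi' :
  is_convolution_power S t phi psi -> is_convolution_power S t phi psi' ->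
  psi =1 psi'.
Proof.
move=> [psi1 h] [psi1' h']; have [kappa kP] := cumulant_exists phi.
apply: eq_on_words => u; have [->|u0] := eqVneq u [::].
  by rewrite ncword_nil psi1 psi1'.
by rewrite (h _ kP).2 // (h' _ kP).2.
Qed.
End Generic.

Lemma interval_partition_top n :
  (0 < n)%N -> @is_interval_partition n [set [set: 'I_n]].
Proof.
move=> n0; apply/andP; split.
  apply/and3P; split; rewrite ?/cover ?big_set1 ?trivIset1 //.
  by rewrite inE eq_sym -card_gt0 cardsT card_ord.
apply/forall_inP => B; rewrite inE => /eqP->.
apply/forall_inP => i _; apply/forall_inP => j _.
by apply/forallP => k; rewrite inE implybT.
Qed.

Lemma noncrossing_partition_top n :
  (0 < n)%N -> @is_noncrossing_partition n [set [set: 'I_n]].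
Proof.
move=> n0; apply/andP; split; first by case/andP: (interval_partition_top n0).
apply/forall_inP => B; rewrite inE => /eqP->.
by apply/forall_inP => B'; rewrite inE => /eqP->; rewrite eqxx.
Qed.

Lemma interval_partitionP n (pi : {set {set 'I_n}}) :
  is_interval_partition pi -> partition pi [set: 'I_n].
Proof. by case/andP. Qed.

Lemma noncrossing_partitionP n (pi : {set {set 'I_n}}) :
  is_noncrossing_partition pi -> partition pi [set: 'I_n].
Proof. by case/andP. Qed.

Definition boolean_cumulant phi : seq 'I_d -> C :=
  sval (cid (cumulant_exists interval_partitionP interval_partition_top phi)).

Definition free_cumulant phi : seq 'I_d -> C :=
  sval (cid (cumulant_exists noncrossing_partitionP noncrossing_partition_top phi)).

Definition boolean_power (t : R) phi : {scalar A} :=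
  sval (cid (convolution_power_exists
               interval_partitionP interval_partition_top t phi)).

Definition free_power (t : R) phi : {scalar A} :=
  sval (cid (convolution_power_exists
               noncrossing_partitionP noncrossing_partition_top t phi)).

Definition belinschi_nica (t : R) phi : {scalar A} :=
  boolean_power (1 + t)^-1 (free_power (1 + t) phi).

Lemma boolean_cumulantP phi :
  is_cumulant is_interval_partition phi (boolean_cumulant phi).
Proof. exact: svalP (cid _). Qed.

Lemma free_cumulantP phi :
  is_cumulant is_noncrossing_partition phi (free_cumulant phi).
Proof. exact: svalP (cid _). Qed.

Lemma boolean_powerP t phi :
  is_convolution_power is_interval_partition t phi (boolean_power t phi).
Proof. exact: svalP (cid _). Qed.

Lemma free_powerP t phi :
  is_convolution_power is_noncrossing_partition t phi (free_power t phi).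
Proof. exact: svalP (cid _). Qed.

Lemma boolean_cumulant_power t phi u :
  boolean_cumulant (boolean_power t phi) u = t%:C%C * boolean_cumulant phi u.
Proof.
have powP := (boolean_powerP t phi).2 _ (boolean_cumulantP phi).
exact: (cumulant_unique interval_partitionP interval_partition_top
          (boolean_cumulantP _) powP u).
Qed.

Lemma free_cumulant_power t phi u :
  free_cumulant (free_power t phi) u = t%:C%C * free_cumulant phi u.
Proof.
have powP := (free_powerP t phi).2 _ (free_cumulantP phi).
exact: (cumulant_unique noncrossing_partitionP noncrossing_partition_top
          (free_cumulantP _) powP u).
Qed.

Definition dilation (s : R) phi : {scalar A} :=
  word_functional (fun u => s%:C%C ^+ size u * phi (ncword u)).

End Cumulants.

Section Meixner.
Context {R : realType} {d : nat}.
Local Notation K := R[i].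
Local Notation A := (ncpoly R d).
Implicit Types (C : 'M[K]_(d * d)) (T : 'I_d -> 'M[K]_d) (phi psi : {scalar A}).

Definition psdmx n (M : 'M[K]_n) : Prop :=
  forall v : 'rV[K]_n, 0 <= (v *m M *m v ^t* ) 0 0.

(* Operators on K^d (x) K^d are matrices indexed through mxtens_index, as in  *)
(* the Kronecker product *t.                                                  *)
Definition meixner_data C T : Prop :=
  [/\ forall i, T i \is hermsymmx,
      is_diag_mx C,
      psdmx (1%:M + C)
    & forall i, (T i *t 1%:M) *m C = C *m (T i *t 1%:M)].

Definition diag_coef C (i j : 'I_d) : K :=
  C (mxtens_index (i, j)) (mxtens_index (i, j)).

Definition meixner_weight C (i : 'I_d) (u : seq 'I_d) : K :=
  if u is l :: _ then 1 + diag_coef C i l else 1.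

(* The recursion for x_i P_(j :: u) involves P_(k :: u) for all k, so that    *)
(* P_u and all the P_(k :: u) are computed together.                          *)
Fixpoint meixner_rec C T (u : seq 'I_d) : A * ('I_d -> A) :=
  if u is j :: v then
    let: (p, q) := meixner_rec C T v in
    (q j, fun i => ncX i * q j - \sum_k T i k j *: q k
                   - ((i == j)%:R * meixner_weight C i v) *: p)
  else (1, ncX).

Definition meixner_poly C T (u : seq 'I_d) : A := (meixner_rec C T u).1.

Lemma meixner_poly_nil C T : meixner_poly C T [::] = 1.
Proof. by []. Qed.

Lemma meixner_poly1 C T i : meixner_poly C T [:: i] = ncX i.
Proof. by []. Qed.

Lemma meixner_polyE C T i j v :
  ncX i * meixner_poly C T (j :: v) =
    meixner_poly C T [:: i, j & v]
    + \sum_k T i k j *: meixner_poly C T (k :: v)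
    + ((i == j)%:R * meixner_weight C i v) *: meixner_poly C T v.
Proof.
by rewrite /meixner_poly /=; case: (meixner_rec C T v) => p q /=; rewrite addrAC !subrK.
Qed.

Definition is_free_meixner C T phi : Prop :=
  unital phi /\ forall u, u != [::] -> phi (meixner_poly C T u) = 0.

Lemma free_meixner_unique C T phi psi :
  is_free_meixner C T phi -> is_free_meixner C T psi -> phi =1 psi.
Proof.
move=> [phi1 phi0] [psi1 psi0]; apply: eq_on_words => u.
rewrite -[ncword u]mulr1 -(meixner_poly_nil C T).
elim/last_ind: u [::] => [|u i IH] v.
  rewrite ncword_nil mul1r; have [->|v0] := eqVneq v [::].
    by rewrite meixner_poly_nil phi1 psi1.
  by rewrite phi0 // psi0.
rewrite ncword_rcons -mulrA; case: v => [|j v].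
  by rewrite meixner_poly_nil mulr1 -(meixner_poly1 C T) IH.
have E (f : {scalar A}) :
    f (ncword u * (ncX i * meixner_poly C T (j :: v))) =
      f (ncword u * meixner_poly C T [:: i, j & v])
      + \sum_k T i k j * f (ncword u * meixner_poly C T (k :: v))
      + (i == j)%:R * meixner_weight C i v * f (ncword u * meixner_poly C T v).
  rewrite meixner_polyE mulrDr mulrDr mulr_sumr [X in f (_ + X)]ncmulZr.
  rewrite linearD linearD linearZ [f (\sum_k _)]linear_sum.
  congr (_ + _ + _); apply: eq_bigr => k _.
  by rewrite ncmulZr linearZ.
rewrite (E phi) (E psi); congr (_ + _ + _ * _); [exact: IH | | exact: IH].
by apply: eq_bigr => k _; congr (_ * _); exact: IH.
Qed.

Let step C T i (u : seq 'I_d) : A :=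
  ncword (i :: u) +
  (if u is j :: v then
     \sum_k T i k j *: ncword (k :: v)
     + ((i == j)%:R * meixner_weight C i v) *: ncword v
   else 0).

Lemma free_meixner_exists C T : exists phi, is_free_meixner C T phi.
Proof.
have [act actE] : exists act : 'I_d -> {linear A -> A},
    forall i u, act i (ncword u) = step C T i u.
  exists (fun i => word_linear (step C T i) : {linear A -> A}) => i u.
  exact: word_linearE.
have [Psi PsiE] : exists Psi : {linear A -> A},
    forall u, Psi (ncword u) = foldr (fun i => act i) 1 u.
  exists (word_linear (foldr (fun i => act i) 1)) => u; exact: word_linearE.
have PsiX i P : Psi (ncX i * P) = act i (Psi P).
  rewrite (ncpolyE P) mulr_sumr [LHS]linear_sum.
  rewrite [X in act i X]linear_sum [RHS]linear_sum.
  apply: eq_bigr => u _.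
  rewrite ncmulZr [LHS]linearZ [X in act i X]linearZ [RHS]linearZ.
  by congr (_ *: _); rewrite -ncword_cons !PsiE.
have Psi1 : Psi 1 = 1 by rewrite -ncword_nil PsiE /= ncword_nil.
have PsiXE i : Psi (ncX i) = ncword [:: i].
  by rewrite -[ncX i]mulr1 PsiX Psi1 -ncword_nil actE /step addr0.
have PsiP u : Psi (meixner_rec C T u).1 = ncword u /\
    forall i, Psi ((meixner_rec C T u).2 i) = ncword (i :: u).
  elim: u => [|j v] /=; first by rewrite Psi1 ncword_nil; split.
  case: (meixner_rec C T v) => p q /= [pE qE]; split=> // i.
  have PsiS : Psi (\sum_k T i k j *: q k) = \sum_k T i k j *: ncword (k :: v).
    rewrite [LHS]linear_sum; apply: eq_bigr => k _.
    by rewrite [LHS]linearZ qE.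
  have PsiZ c : Psi (c *: p) = c *: ncword v by rewrite [LHS]linearZ pE.
  rewrite [LHS]linearB [X in X - _]linearB PsiS PsiZ PsiX qE actE /step.
  by rewrite -addrA -opprD addrK.
pose phi : {scalar A} := word_functional (fun u => (Psi (ncword u) : A)@_(FMonom [::])).
have phiE P : phi P = (Psi P : A)@_(FMonom [::]).
  rewrite [in RHS](ncpolyE P) linear_sum raddf_sum; apply: eq_bigr => u _.
  have -> : Psi (P@_u *: ncword u) = P@_u *: Psi (ncword u) by exact: linearZ.
  exact: esym (mcoeffZ _ _ _).
exists phi; split; first by rewrite /unital phiE Psi1 mcoeff1 fmP fm1 eqxx.
move=> u u0; rewrite phiE (PsiP u).1 ncwordE mcoeffU1.
by rewrite fmP (negPf u0).
Qed.

Definition free_meixner C T : {scalar A} := sval (cid (free_meixner_exists C T)).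

Lemma free_meixnerP C T : is_free_meixner C T (free_meixner C T).
Proof. exact: svalP (cid _). Qed.

(* Membership in the class forces unit covariance; membership up to dilation  *)
(* is meant for functionals such as convolution powers, of covariance t I.    *)
Definition in_meixner_class phi : Prop :=
  exists C T, meixner_data C T /\ phi =1 free_meixner C T.

Definition in_meixner_class_upto_dilation phi : Prop :=
  exists2 s : R, 0 < s & in_meixner_class (dilation s phi).

End Meixner.

(* The two-point distribution (1 + b^2)^-1 delta_b + b^2 (1 + b^2)^-1          *)
(* delta_(- 1 / b) is identified with its moment functional; when d = 1 the   *)
(* word u is the power x ^+ size u.                                           *)
Definition bernoulli {R : realType} (b : R) : {scalar ncpoly R 1} :=
  word_functional (fun u =>
    ((1 + b ^+ 2)^-1 * b ^+ size u
     + b ^+ 2 / (1 + b ^+ 2) * (- b^-1) ^+ size u)%:C%C).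

(* Main.v *)
Require Import Defs.
From mathcomp Require Import all_boot all_order all_algebra.
From mathcomp Require Import sesquilinear spectral complex mxtens.
From mathcomp Require Import finmap monalg.
From mathcomp Require Import boolp reals.
From mathcomp Require Import ring.

(** Let X_1, ..., X_d act on the free vector space with basis the words s over
    the letters 1, ..., d as follows: X_j sends e_s to e_(j s) (creation),
    applies T_j to the first letter of s (preservation), and sends e_(j s) to
    e_s (annihilation) with a weight which is alpha when s is empty and g j i
    when s starts with i.  The coefficient of the empty word in
    X_u1 ... X_un e_empty is a unital functional of u, written
    [fock alpha T g u [::]]; the free Meixner functional is the case alpha = 1,
    g j i = 1 + C_ji ([free_meixner_fock]), because the polynomials P_u are
    exactly those with P_u(X) e_empty = e_u.

    The theorem reduces to the way (alpha, T, g) changes under powers.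
    - The Boolean power t sends (alpha, T, g) to (t alpha, T, g).
    - The free power t sends (alpha, T, alpha + c) to (t alpha, T, t alpha + c).
    So B_t, which is a free power 1 + t followed by a Boolean power
    1 / (1 + t), turns (1, T, 1 + C) into (1, T, 1 + t + C).  A dilation by r
    multiplies alpha and g by r^2 and T by r, hence r = t^(-1/2) brings back
    alpha = 1 after a power t; what has to be checked is that the new weights
    g are nonnegative.  After a free power t they are t + C_ij, which is clear
    when t >= 1, and which for a state is read off from the squared norm
    t (t + C_ij) of a polynomial of degree 2 ([fock_state_ge0]).  Finally, in
    one variable the Meixner functional with C = -1 has g = 0, so it lives on a
    2-dimensional space: it is the Bernoulli law whose atoms beta and
    - 1 / beta are the roots of x^2 = T x + 1, and every other C >= -1 is
    reached from it by B_(1 + C).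

    Both rules for powers come from one description of the cumulants
    ([fock_moment]): the cumulant of i v is alpha times [fock 0 T c v [:: i]],
    the sum over the paths from e_i that meet the empty word only at their end,
    with c = g in the Boolean case and c = g - alpha in the free case.  To see
    this, read a word letter by letter.  A noncrossing partition under
    construction is a stack of open blocks, and each letter either opens a
    block on top of the stack or is appended to the top block; for an interval
    partition at most one block is open.  An open block only matters through
    the functional v |-> kappa (letters so far ++ v), and the sum over all ways
    of completing a stack is multilinear in these functionals
    ([stack_moment_linear]).  Attach to a word s the functional
    v |-> fock 0 T c v s, and to a stack of words their concatenation.  With
    i s on top of the stack, opening a block with the letter j gives the stack
    (j), (i s), while appending j gives, among other terms, c j i times
    the stack (j i s): both stand for the same basis vector e_(j i s), whose
    total weight is alpha + c j i when nesting is allowed and c j i when it is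
    not.  This is [fock_stack_moment].

    The sums over set partitions are identified with these stack sums by
    fixing the positions below k of all blocks and letting k grow
    ([stack_sum_step]); an interval partition is a noncrossing partition all of
    whose blocks are convex, so it is obtained by giving weight 0 to the other
    blocks. *)

Import Order.TTheory GRing.Theory Num.Theory.
Local Open Scope ring_scope.

Set Implicit Arguments.
Unset Strict Implicit.
Unset Printing Implicit Defensive.

(** * Noncrossing partitions as stacks of open blocks *)

Section BlockStacks.
Context {n : nat}.
Implicit Types (pi : {set {set 'I_n}}) (a b B : {set 'I_n}) (bs st : seq {set 'I_n}).

Definition crossing B B' : bool :=
  [exists i in B, exists j in B', exists k in B, exists l in B',
     [&& i < j, j < k & k < l]%N].

Definition noncrossing pi : bool :=
  [forall B in pi, forall B' in pi, (B != B') ==> ~~ crossing B B'].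

Lemma noncrossingP pi :
  reflect {in pi &, forall B B', B != B' -> ~~ crossing B B'} (noncrossing pi).
Proof.
apply: (iffP forall_inP) => [nc B B' piB piB'|nc B piB].
  by have /forall_inP/(_ B' piB')/implyP := nc B piB.
by apply/forall_inP => B' piB'; apply/implyP; apply: nc.
Qed.

Lemma crossingP B B' :
  reflect (exists i j k l, [/\ i \in B, j \in B', k \in B & l \in B'] /\
             [/\ i < j, j < k & k < l]%N)
          (crossing B B').
Proof.
apply: (iffP idP) => [|[i [j [k [l [[Bi B'j Bk B'l] [ij jk kl]]]]]]].
  case/exists_inP => i Bi /exists_inP[j B'j /exists_inP[k Bk /exists_inP[l B'l]]].
  by case/and3P; exists i, j, k, l.
apply/exists_inP; exists i => //; apply/exists_inP; exists j => //.
apply/exists_inP; exists k => //; apply/exists_inP; exists l => //.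
by rewrite ij jk kl.
Qed.

Definition below (k : nat) : {set 'I_n} := [set x : 'I_n | (x < k)%N].

(** The positions that the blocks of a completion of the stack [bs] occupy:
    those already placed in an open block, and all those from [k] on. *)
Definition stack_ground bs (k : nat) : {set 'I_n} :=
  (\bigcup_(b <- bs) b) :|: ~: below k.

(** The partitions that remain to be summed over when the positions below
    [k] have been read and the open blocks, from top to bottom, are [bs].
    Closed blocks are left out of the partition, so every block continues at
    or beyond [k]; [set0] stands for the blocks that are not yet started. *)
Definition completes bs (k : nat) pi : bool :=
  [&& partition pi (stack_ground bs k), noncrossing pi
    & [forall B in pi, (B :&: below k \in set0 :: bs) && ~~ (B \subset below k)]].

Lemma in_stack_ground bs k x :
  (x \in stack_ground bs k) = has (fun b => x \in b) bs || (k <= x)%N.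
Proof.
rewrite !inE -leqNgt; congr (_ || _).
elim: bs => [|b bs IH] /=; first by rewrite big_nil inE.
by rewrite big_cons inE IH.
Qed.

(** A position can only be appended to the top block, hence every element of
    a block is larger than all elements of the blocks below it. *)
Definition ordered_stack bs (k : nat) : Prop :=
  [/\ {in bs, forall b, b != set0}, {in bs, forall b, b \subset below k}
    & pairwise (fun b b' => [forall x in b, forall y in b', (y < x)%N]) bs].

Lemma completesP bs k pi :
  reflect [/\ partition pi (stack_ground bs k), noncrossing pi,
              {in pi, forall B, B :&: below k \in set0 :: bs}
            & {in pi, forall B, exists2 x, x \in B & (k <= x)%N}]
          (completes bs k pi).
Proof.
apply: (iffP and3P) => [[-> -> /forall_inP h]|[-> -> tr out]]; split=> //.
- by move=> B /h/andP[].
- by move=> B /h/andP[_ /subsetPn[x Bx]]; rewrite inE -leqNgt; exists x.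
apply/forall_inP => B piB; rewrite tr //=; apply/subsetPn.
by have [x Bx kx] := out B piB; exists x; rewrite // inE -leqNgt.
Qed.

Lemma belowS (k : 'I_n) : below k.+1 = k |: below k.
Proof. by apply/setP => x; rewrite !inE ltnS leq_eqVlt. Qed.

Lemma setI_belowS (k : 'I_n) B :
  B :&: below k.+1 = if k \in B then k |: (B :&: below k) else B :&: below k.
Proof.
rewrite belowS; apply/setP => x; rewrite !inE.
case: ifP => kB; rewrite !inE; case: eqVneq => [->|] //=.
  by rewrite kB.
by rewrite kB.
Qed.

Lemma setI_belowSK (k : 'I_n) B : B :&: below k.+1 :&: below k = B :&: below k.
Proof.
rewrite -setIA; congr (_ :&: _); apply/setIidPr/subsetP => x.
by rewrite !inE => /ltnW.
Qed.

Definition stack_sum (K : comNzRingType) (F : {set 'I_n} -> K) bs k : K :=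
  \sum_(pi | completes bs k pi) \prod_(B in pi) F B.

(** Removing a common block from partitions is a bijection. *)
Lemma sum_with_block (K : comNzRingType) (F : {set 'I_n} -> K)
    (P : pred {set {set 'I_n}}) c :
  \sum_(pi | P pi && (c \in pi)) \prod_(B in pi) F B =
  F c * \sum_(pi | P (c |: pi) && (c \notin pi)) \prod_(B in pi) F B.
Proof.
rewrite mulr_sumr (reindex_onto (fun pi => c |: pi) (fun pi => pi :\ c)) /=.
  apply: eq_big => [pi|pi].
    rewrite setU11 andbT; congr (_ && _); apply/eqP/idP => [<-|]; last exact: setU1K.
    by rewrite !inE eqxx.
  move=> /andP[_ /eqP e]; rewrite big_setU1 //=.
  by rewrite -e !inE eqxx.
by move=> pi /andP[_ cpi]; rewrite setD1K.
Qed.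

Lemma completes_set0 bs k pi : completes (set0 :: bs) k pi = completes bs k pi.
Proof.
rewrite /completes /stack_ground big_cons set0U; congr [&& _, _ & _].
by apply: eq_forallb => B; rewrite !inE orbA orbb.
Qed.

(** In this section [a] is the part below [k] of the block that receives the
    position [k]: either the top of the stack, or empty when [k] starts a
    block. *)
Section Step.
Variables (a : {set 'I_n}) (st : seq {set 'I_n}) (k : 'I_n).
Hypothesis a_below : a \subset below k.
Hypothesis st_below : {in st, forall b, b \subset below k}.
Hypothesis st_lt : {in st, forall b, forall x y, x \in a -> y \in b -> (y < x)%N}.

Let c := k |: a.

Lemma ltk_a x : x \in a -> (x < k)%N.
Proof. by move=> /(subsetP a_below); rewrite inE. Qed.

Lemma ltk_st b x : b \in st -> x \in b -> (x < k)%N.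
Proof. by move=> /st_below/subsetP sub /sub; rewrite inE. Qed.

Lemma top_below : c :&: below k = a.
Proof.
apply/setP => x; rewrite !inE; case: eqVneq => [->|_] /=.
  by rewrite ltnn; apply/esym/negP => /ltk_a; rewrite ltnn.
by apply/andb_idr => /ltk_a.
Qed.

Lemma notin_st x b : x \in c -> b \in st -> x \notin b.
Proof.
rewrite !inE => /orP[/eqP->|xa] bst; apply/negP.
  by move=> /(ltk_st bst); rewrite ltnn.
by move=> /(st_lt bst xa); rewrite ltnn.
Qed.

Lemma ground_keep : stack_ground (a :: st) k = stack_ground (c :: st) k.+1.
Proof.
apply/setP => x; rewrite !in_stack_ground /= !inE.
rewrite [(k <= x)%N]leq_eqVlt (eq_sym x) -val_eqE.
by case: (val k == val x); case: (x \in a); rewrite ?orbT.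
Qed.

Lemma ground_close : stack_ground (a :: st) k = c :|: stack_ground st k.+1.
Proof.
rewrite ground_keep; apply/setP => x.
by rewrite in_stack_ground in_setU in_stack_ground /= orbA.
Qed.

Lemma top_disjoint : [disjoint c & stack_ground st k.+1].
Proof.
apply/pred0P => x /=; apply/negbTE/negP => /andP[cx].
rewrite in_stack_ground => /orP[/hasP[b bst bx]|kx].
  by have := notin_st cx bst; rewrite bx.
move: cx kx; rewrite !inE => /orP[/eqP->|/ltk_a/ltnW]; first by rewrite ltnn.
by rewrite leqNgt => /negPf->.
Qed.

Lemma completes_keep pi :
  [&& completes (a :: st) k pi, pblock pi k :&: below k == a
    & ~~ (pblock pi k \subset below k.+1)] = completes (c :: st) k.+1 pi.
Proof.
apply/and3P/idP => [[/completesP[part nc tr out] /eqP ka kout]|].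
  have triv := partition_trivIset part.
  apply/completesP; split=> //; first by rewrite -ground_keep.
    move=> B piB; rewrite setI_belowS; case: ifP => kB.
      by rewrite -(def_pblock triv piB kB) ka !inE eqxx orbT.
    have := tr B piB; rewrite !inE => /or3P[->//|/eqP Ba|->]; last by rewrite !orbT.
    rewrite Ba; have [->|[x xa]] := set_0Vmem a; first by rewrite eqxx.
    have xB : x \in B by move: xa; rewrite -Ba inE => /andP[].
    have xk : x \in pblock pi k by move: xa; rewrite -ka inE => /andP[].
    have kpi : k \in cover pi.
      by rewrite (cover_partition part) in_stack_ground leqnn orbT.
    move: kB; rewrite -(def_pblock triv piB xB).
    by rewrite (def_pblock triv (pblock_mem kpi) xk) mem_pblock kpi.
  move=> B piB; have [x xB kx] := out B piB.
  have [kB|kB] := boolP (k \in B).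
    move: kout; rewrite (def_pblock triv piB kB) => /subsetPn[y By].
    by rewrite inE -leqNgt; exists y.
  exists x => //; rewrite ltn_neqAle kx andbT; apply: contraNneq kB => kx'.
  by rewrite (val_inj kx' : k = x).
move=> /completesP[part nc tr out].
have kpi : k \in cover pi.
  by rewrite (cover_partition part) -ground_keep in_stack_ground leqnn orbT.
have pik := pblock_mem kpi.
have kk : k \in pblock pi k by rewrite mem_pblock.
split.
- apply/completesP; split=> //; first by rewrite ground_keep.
    move=> B piB; rewrite -setI_belowSK; have := tr B piB.
    rewrite !inE => /or3P[/eqP->|/eqP->|bst]; first by rewrite set0I eqxx.
      by rewrite top_below eqxx orbT.
    by rewrite (setIidPl (st_below bst)) bst !orbT.
  by move=> B piB; have [x xB /ltnW kx] := out B piB; exists x.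
- have kk' : k \in pblock pi k :&: below k.+1 by rewrite !inE kk /=.
  rewrite -setI_belowSK; have := tr _ pik; rewrite [_ \in _]inE in_cons.
  case/or3P=> [/eqP e|/eqP->|bst]; [by rewrite e inE in kk' | by rewrite top_below|].
  by have := ltk_st bst kk'; rewrite ltnn.
- have [x xB kx] := out _ pik; apply/subsetPn; exists x => //.
  by rewrite inE ltnS -ltnNge.
Qed.

(** The block of [k] ends there and is removed.  It cannot cross another
    block [B]: the elements of [B] that are not beyond [k] belong to a lower
    open block, so they precede all elements of [c]. *)
Lemma completes_close pi :
  completes (a :: st) k (c |: pi) && (c \notin pi) = completes st k.+1 pi.
Proof.
have c0 : c != set0 by apply/set0Pn; exists k; rewrite setU11.
apply/andP/idP => [[/completesP[part nc tr out] cpi]|/completesP[part nc tr out]].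
  have part' : partition pi (stack_ground st k.+1).
    have := partitionD1 part (setU11 c pi); rewrite setU1K // ground_close.
    rewrite setDUl setDv set0U; congr partition.
    by apply/setDidPl; rewrite disjoint_sym top_disjoint.
  have outc B x : B \in pi -> x \in c -> x \notin B.
    move=> piB cx; apply/negP => Bx.
    have := subsetP (partitionS part' piB) x Bx.
    by rewrite (disjointFr top_disjoint cx).
  have kc : k \in c by rewrite setU11.
  have kB B : B \in pi -> k \notin B by move=> piB; apply: outc.
  apply/completesP; split=> //.
  - apply/noncrossingP => B B' piB piB'.
    by apply: (noncrossingP _ nc); rewrite setU1r.
  - move=> B piB; rewrite setI_belowS (negPf (kB B piB)).
    have := tr B (setU1r _ piB); rewrite !inE => /or3P[->//|/eqP Ba|->]; last first.
      by rewrite orbT.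
    rewrite Ba; have [->|[x xa]] := set_0Vmem a; first by rewrite eqxx.
    have := outc B x piB (setU1r _ xa); move: xa.
    by rewrite -Ba inE => /andP[->].
  - move=> B piB; have [x xB kx] := out B (setU1r _ piB); exists x => //.
    rewrite ltn_neqAle kx andbT; apply: contraNneq (kB B piB) => kx'.
    by rewrite (val_inj kx' : k = x).
have cpi : c \notin pi.
  apply/negP => cpi; have [x] := out c cpi.
  by rewrite !inE => /orP[/eqP->|/ltk_a/ltnW]; rewrite ?ltnn // leqNgt => /negPf->.
have side B y : B \in pi -> y \in B ->
    (forall x, x \in c -> (x < y)%N) \/ (forall x, x \in c -> (y < x)%N).
  move=> piB By; have [yk|ky] := ltnP k y.
    left=> x; rewrite !inE => /orP[/eqP->//|/ltk_a xk].
    exact: ltn_trans xk yk.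
  right; have : y \in B :&: below k.+1 by rewrite !inE By ltnS.
  have := tr B piB; rewrite inE => /orP[/eqP->|bst]; first by rewrite inE.
  move=> yb x; rewrite !inE => /orP[/eqP->|xa]; first exact: ltk_st bst yb.
  exact: st_lt bst _ _ xa yb.
split=> //; apply/completesP; split.
- rewrite ground_close; exact: partitionU1 part c0 top_disjoint.
- apply/noncrossingP => B B'; rewrite !inE.
  case/predU1P=> [->|piB] /predU1P[->|piB']; first by rewrite eqxx.
  + move=> _; apply/crossingP => -[i [j [l [m [[ci Bj cl Bm] [ij jl lm]]]]]].
    have [/(_ l cl) lj|/(_ i ci) ji] := side B' j piB' Bj.
      by move: (ltn_trans jl lj); rewrite ltnn.
    by move: (ltn_trans ij ji); rewrite ltnn.
  + move=> _; apply/crossingP => -[i [j [l [m [[Bi cj Bl cm] [ij jl lm]]]]]].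
    have [/(_ m cm) ml|/(_ j cj) lj] := side B l piB Bl.
      by move: (ltn_trans lm ml); rewrite ltnn.
    by move: (ltn_trans jl lj); rewrite ltnn.
  + exact: (noncrossingP _ nc).
- move=> B /setU1P[->|piB].
    by rewrite top_below !inE eqxx orbT.
  rewrite -setI_belowSK; have := tr B piB; rewrite !inE.
  case/orP=> [/eqP->|bst]; first by rewrite set0I eqxx.
  by rewrite (setIidPl (st_below bst)) bst !orbT.
- move=> B /setU1P[->|piB].
    by exists k; rewrite ?setU11.
  by have [x xB /ltnW kx] := out B piB; exists x.
Qed.

Variables (K : comNzRingType) (F : {set 'I_n} -> K).

(** For a given [a], the block of [k] is either kept open or closed; a
    closed block is exactly [c] and contributes its weight. *)
Lemma sum_top_block :
  \sum_(pi | completes (a :: st) k pi && (pblock pi k :&: below k == a))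
     \prod_(B in pi) F B =
  stack_sum F (c :: st) k.+1 + F c * stack_sum F st k.+1.
Proof.
rewrite (bigID (fun pi => ~~ (pblock pi k \subset below k.+1))) /=; congr (_ + _).
  by apply: eq_bigl => pi; rewrite -andbA completes_keep.
rewrite /stack_sum -(eq_bigl _ _ completes_close) -sum_with_block.
apply: eq_bigl => pi; rewrite negbK -andbA.
have [/completesP[part _ _ _]|//] := boolP (completes (a :: st) k pi).
have triv := partition_trivIset part.
have kpi : k \in cover pi.
  by rewrite (cover_partition part) in_stack_ground leqnn orbT.
rewrite /=; apply/andP/idP => [[/eqP ka sub]|cpi].
  have <- : pblock pi k = c; last exact: pblock_mem.
  by rewrite -(setIidPl sub) setI_belowS mem_pblock kpi ka.
rewrite (def_pblock triv cpi (setU11 _ _)) top_below eqxx; split=> //.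
by rewrite belowS setUS.
Qed.

End Step.

(** The recursion of noncrossing partitions: [k] starts a block or continues
    the top one, since continuing a lower block would cross the top block,
    which still has to receive an element beyond [k]. *)
Lemma stack_sum_step (K : comNzRingType) (F : {set 'I_n} -> K) bs (k : 'I_n) :
  ordered_stack bs k ->
  stack_sum F bs k =
    stack_sum F ([set k] :: bs) k.+1 + F [set k] * stack_sum F bs k.+1
    + (if bs is b :: st then
         stack_sum F ((k |: b) :: st) k.+1 + F (k |: b) * stack_sum F st k.+1
       else 0).
Proof.
move=> [bs0 bsk ord].
have := @sum_top_block set0 bs k (sub0set _) bsk _ K F.
rewrite setU0 => <-; last by move=> b _ x y; rewrite inE.
rewrite [LHS](bigID (fun pi => pblock pi k :&: below k == set0)) /=.
congr (_ + _).
  by apply: eq_bigl => pi; rewrite completes_set0.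
case: bs bs0 bsk ord => [|b st] bs0 bsk ord.
  apply: big_pred0 => pi; apply/andP => -[/completesP[part _ tr _]].
  have kpi : k \in cover pi.
    by rewrite (cover_partition part) in_stack_ground leqnn orbT.
  by have := tr _ (pblock_mem kpi); rewrite inE => ->.
have b0 : b != set0 by rewrite bs0 ?mem_head.
have lt_bst : {in st, forall b', forall x y, x \in b -> y \in b' -> (y < x)%N}.
  move=> b' b'st x y xb yb'; case/andP: ord => /allP/(_ b' b'st).
  by move=> /forall_inP/(_ x xb)/forall_inP/(_ y yb').
have sub : {in st, forall b', b' \subset below k}.
  by move=> b' b'st; rewrite bsk // inE b'st orbT.
rewrite -(sum_top_block (bsk b (mem_head _ _)) sub lt_bst).
apply: eq_bigl => pi; have [/completesP[part nc tr out]|//] := boolP (completes _ _ _).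
have triv := partition_trivIset part.
have kpi : k \in cover pi.
  by rewrite (cover_partition part) in_stack_ground leqnn orbT.
have := tr _ (pblock_mem kpi); rewrite !inE /= => /or3P[/eqP->|/eqP->|].
- by rewrite eqxx eq_sym (negPf b0).
- by rewrite b0 eqxx.
set s := _ :&: _ => sst.
have [y ys] := set0Pn _ (bs0 s (mem_behead (s := b :: st) sst)).
have [x xb] := set0Pn _ b0.
have [yk ylt] : y \in pblock pi k /\ (y < k)%N.
  by move: ys; rewrite !inE => /andP[].
have xpi : x \in cover pi.
  by rewrite (cover_partition part) in_stack_ground /= xb.
have xx : x \in pblock pi x by rewrite mem_pblock.
have [z zx kz] := out _ (pblock_mem xpi).
have xltk : (x < k)%N by have := subsetP (bsk b (mem_head _ _)) x xb; rewrite inE.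
have xk : x \notin pblock pi k.
  apply/negP => xk; have xs : x \in s by rewrite !inE xk.
  by have := lt_bst s sst x x xb xs; rewrite ltnn.
have neq : pblock pi k != pblock pi x by apply: contraNneq xk => ->.
have kx : k \notin pblock pi x.
  apply: contra neq => kx; apply/eqP.
  exact: def_pblock triv (pblock_mem xpi) kx.
have kltz : (k < z)%N.
  rewrite ltn_neqAle kz andbT; apply: contraNneq kx => kz'.
  by rewrite (val_inj kz' : k = z).
have /negP[] := noncrossingP _ nc _ _ (pblock_mem kpi) (pblock_mem xpi) neq.
apply/crossingP; exists y, x, k, z; split; split=> //.
  by rewrite mem_pblock.
exact: lt_bst sst _ _ xb ys.
Qed.

(** With no position left an open block can no longer be completed. *)
Lemma stack_sum_end (K : comNzRingType) (F : {set 'I_n} -> K) bs :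
  ordered_stack bs n -> stack_sum F bs n = (bs == [::])%:R.
Proof.
move=> [bs0 _ _].
have onlynil pi : completes bs n pi -> pi = set0 /\ bs = [::].
  move=> /completesP[part _ _ out].
  have pi0 : pi = set0.
    apply/setP => B; rewrite inE; apply/negP => piB.
    by have [x _] := out B piB; rewrite leqNgt ltn_ord.
  split=> //; case: bs bs0 part {out} => [//|b bs] bs0.
  have [x xb] := set0Pn _ (bs0 b (mem_head _ _)).
  rewrite pi0 => /cover_partition; rewrite /cover big_set0 => /setP/(_ x).
  by rewrite inE in_stack_ground /= xb.
case: bs bs0 onlynil => [|b bs] bs0 onlynil.
  rewrite /stack_sum (big_pred1 set0) ?big_set0 // => pi.
  apply/idP/eqP => [/onlynil[]//|->]; apply/completesP; split.
  - have -> : stack_ground [::] n = set0; last by rewrite partition_set0.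
    by apply/setP => x; rewrite in_stack_ground inE /= leqNgt ltn_ord.
  - by apply/noncrossingP => B; rewrite inE.
  - by move=> B; rewrite inE.
  - by move=> B; rewrite inE.
by apply: big_pred0 => pi; apply/negP => /onlynil[].
Qed.

Lemma stack_sum_start (K : comNzRingType) (F : {set 'I_n} -> K) :
  stack_sum F [::] 0 = \sum_(pi | is_noncrossing_partition pi) \prod_(B in pi) F B.
Proof.
apply: eq_bigl => pi; rewrite /completes /is_noncrossing_partition.
have -> : stack_ground [::] 0 = [set: 'I_n].
  by apply/setP => x; rewrite in_stack_ground inE.
apply/and3P/andP => [[]//|[part nc]]; split=> //; apply/forall_inP => B piB.
have b0 : below 0 = set0 by apply/setP => x; rewrite !inE.
by rewrite b0 setI0 inE eqxx subset0 (partition_neq0 part).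
Qed.

End BlockStacks.

(** * The stack sum for words *)

Section StackMoment.
Variables (K : comNzRingType) (I : Type).
Implicit Types (f g h : seq I -> K) (fs pre post : seq (seq I -> K)) (w : seq I).

Definition tail_functional f (j : I) : seq I -> K := fun v => f (j :: v).

(** The same recursion on words.  A stack is a list of functionals: the
    value at [v] of the functional of an open block is the cumulant of the
    block if it receives precisely the letters [v].  The boolean tells
    whether a block may be opened on top of another one. *)
Fixpoint stack_moment (nest : bool) (kappa : seq I -> K) w fs : K :=
  if w is j :: w' then
    (if nest || nilp fs then
       stack_moment nest kappa w' (tail_functional kappa j :: fs)
       + kappa [:: j] * stack_moment nest kappa w' fs
     else 0)
    + (if fs is f :: fs' then
         stack_moment nest kappa w' (tail_functional f j :: fs')
         + f [:: j] * stack_moment nest kappa w' fs'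
       else 0)
  else (nilp fs)%:R.

(** The relation is asked at nonempty words, because an open block still has
    to grow.  The prefix [pre] is for the induction: opening a block puts a
    new functional above the one in which linearity is claimed. *)
Lemma stack_moment_linear nest kappa c f g h w pre post :
  (forall v, ~~ nilp v -> h v = c * f v + g v) ->
  stack_moment nest kappa w (pre ++ h :: post) =
    c * stack_moment nest kappa w (pre ++ f :: post)
    + stack_moment nest kappa w (pre ++ g :: post).
Proof.
elim: w pre f g h => [|j w IH] pre f g h hE.
  by rewrite /= /nilp !size_cat /= addnS /= mulr0 addr0.
have hEj v : tail_functional h j v = c * tail_functional f j v + tail_functional g j v.
  exact: hE.
case: pre => [|p pre] /=; last first.
  rewrite (IH [:: _, _ & pre] f g h) // !(IH (_ :: pre) f g h) // (IH pre f g h) //.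
  by case: nest {IH} => /=; ring.
rewrite (IH [::] _ _ _ (fun v _ => hEj v)) hE //.
rewrite (IH [:: _] f g h) // (IH [::] f g h) //.
by case: nest {IH} => /=; ring.
Qed.

Lemma eq_stack_moment nest kappa f g w post :
  (forall v, ~~ nilp v -> f v = g v) ->
  stack_moment nest kappa w (f :: post) = stack_moment nest kappa w (g :: post).
Proof.
move=> fg.
(* f = 1 * 0 + g away from the empty word; the zero functional contributes 0
   because 0 = - 0 + 0. *)
have /(_ w [::] post) /= := @stack_moment_linear nest kappa 1 (fun=> 0) g f.
move=> -> => [|v v0]; last by rewrite mulr0 add0r fg.
have /(_ w [::] post) /= :=
  @stack_moment_linear nest kappa (-1) (fun=> 0) (fun=> 0) (fun=> 0).
by move=> -> => [|v _]; ring.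
Qed.

Lemma stack_moment0 nest kappa f w post :
  (forall v, ~~ nilp v -> f v = 0) -> stack_moment nest kappa w (f :: post) = 0.
Proof.
move=> f0.
(* f = - f + f away from the empty word. *)
have /(_ w [::] post) /= := @stack_moment_linear nest kappa (-1) f f f.
by move=> -> => [|v v0]; [ring | rewrite f0 //; ring].
Qed.

Lemma stack_momentD nest kappa f g w post :
  stack_moment nest kappa w ((fun v => f v + g v) :: post) =
    stack_moment nest kappa w (f :: post) + stack_moment nest kappa w (g :: post).
Proof.
have /(_ w [::] post) /= := @stack_moment_linear nest kappa 1 f g (fun v => f v + g v).
by move=> -> => [|v _]; rewrite mul1r.
Qed.

Lemma stack_momentZ nest kappa c f w post :
  stack_moment nest kappa w ((fun v => c * f v) :: post) =
    c * stack_moment nest kappa w (f :: post).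
Proof.
have /(_ w [::] post) /= :=
  @stack_moment_linear nest kappa c f (fun=> 0) (fun v => c * f v).
move=> -> => [|v _]; last by rewrite addr0.
by rewrite [X in _ + X]stack_moment0 ?addr0.
Qed.

Lemma stack_moment_sum nest kappa (J : Type) (r : seq J) (f : J -> seq I -> K) w post :
  stack_moment nest kappa w ((fun v => \sum_(x <- r) f x v) :: post) =
    \sum_(x <- r) stack_moment nest kappa w (f x :: post).
Proof.
elim: r => [|x r IH].
  by rewrite big_nil; apply: stack_moment0 => v _; rewrite big_nil.
rewrite big_cons -IH -stack_momentD; apply: eq_stack_moment => v _.
by rewrite big_cons.
Qed.

End StackMoment.

(** * Sums over noncrossing and interval partitions of a word *)

Section PartitionMoments.
Variables (K : comNzRingType) (d : nat) (kappa : seq 'I_d -> K) (u : seq 'I_d).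
Local Notation n := (size u).
Implicit Types (B b : {set 'I_n}) (bs : seq {set 'I_n}).

Definition open_block b : seq 'I_d -> K := fun v => kappa (subword b ++ v).

(** Positions are read from left to right, so a block grows at its end. *)
Lemma subword_setU1 (k : 'I_n) b :
  b \subset below k -> subword (k |: b) = rcons (subword b) (tnth (in_tuple u) k).
Proof.
move=> bk; rewrite /subword -map_rcons; congr map.
have ltk x : x \in enum b -> (x < k)%N.
  by rewrite mem_enum => /(subsetP bk); rewrite inE.
have ltT : transitive (fun x y : 'I_n => (x < y)%N) by move=> x y z; apply: ltn_trans.
have srt (A : {set 'I_n}) : sorted (fun x y : 'I_n => (x < y)%N) (enum A).
  have -> : enum A = filter (mem A) (enum 'I_n) by rewrite enumT.
  apply: sorted_filter => //.
  rewrite -[sorted _ _]/(sorted (relpre val ltn) _) -sorted_map.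
  by rewrite val_enum_ord iota_ltn_sorted.
apply: (irr_sorted_eq ltT) => // [x||x]; first exact: ltnn.
- case E: (enum b) (srt b) => [//|x s] /=.
  rewrite rcons_path => -> /=; apply: ltk.
  rewrite E; case/lastP: s {E} => [|s y]; first exact: mem_head.
  by rewrite last_rcons inE mem_rcons mem_head orbT.
- by rewrite mem_rcons in_cons !mem_enum !inE.
Qed.

Lemma ordered_stack_le bs (k l : nat) :
  (k <= l)%N -> ordered_stack bs k -> ordered_stack bs l.
Proof.
move=> kl [bs0 bsk ord]; split=> // b /bsk/subsetP bk.
by apply/subsetP => x /bk; rewrite !inE => /leq_trans; apply.
Qed.

Lemma ordered_stack_push bs (k : 'I_n) :
  ordered_stack bs k -> ordered_stack ([set k] :: bs) k.+1.
Proof.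
move=> obs; have [bs0' bsk' ord'] := ordered_stack_le (leqnSn k) obs.
have [_ bsk _] := obs; split.
- by move=> b; rewrite inE => /orP[/eqP->|/bs0'//]; apply/set0Pn; exists k; rewrite inE.
- by move=> b; rewrite inE => /orP[/eqP->|/bsk'//]; rewrite sub1set inE.
apply/andP; split=> //; apply/allP => b bbs; apply/forall_inP => x /set1P->.
by apply/forall_inP => y yb; have := subsetP (bsk b bbs) y yb; rewrite inE.
Qed.

Lemma ordered_stack_grow b bs (k : 'I_n) :
  ordered_stack (b :: bs) k -> ordered_stack ((k |: b) :: bs) k.+1.
Proof.
move=> obs; have [bs0' bsk' ord'] := ordered_stack_le (leqnSn k) obs.
have [_ bsk _] := obs; split.
- move=> b'; rewrite inE => /orP[/eqP->|b'bs]; last by rewrite bs0' // inE b'bs orbT.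
  by apply/set0Pn; exists k; rewrite !inE eqxx.
- move=> b'; rewrite inE => /orP[/eqP->|b'bs]; last by rewrite bsk' // inE b'bs orbT.
  by rewrite subUset sub1set inE leqnn bsk' ?mem_head.
case/andP: ord' => /allP ord1 ord2; apply/andP; split=> //; apply/allP => b' b'bs.
apply/forall_inP => x; rewrite !inE => /orP[/eqP->|xb]; last first.
  exact: (forall_inP (ord1 b' b'bs)).
apply/forall_inP => y yb'; have := subsetP (bsk b' _) y yb'.
by rewrite !inE b'bs orbT; apply.
Qed.

Lemma ordered_stack_pop b bs k : ordered_stack (b :: bs) k -> ordered_stack bs k.
Proof.
move=> [bs0 bsk /andP[_ ord]]; split=> // b' b'bs; rewrite ?bs0 ?bsk //.
all: by rewrite inE b'bs orbT.
Qed.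

Lemma ordered_stack_nil k : ordered_stack ([::] : seq {set 'I_n}) k.
Proof. by split. Qed.

(** The recursions for position sets and for words agree: only the letters
    read by an open block matter for its future weight. *)
Lemma noncrossing_stack_sum (k : nat) bs :
  (k <= n)%N -> ordered_stack bs k ->
  stack_sum (fun B => kappa (subword B)) bs k =
    stack_moment true kappa (drop k u) [seq open_block b | b <- bs].
Proof.
move=> kn obs; move uk : (drop k u) => w.
elim: w k bs kn obs uk => [|j w IH] k bs kn obs uk.
  have k_n : k = n.
    by apply/eqP; rewrite eqn_leq kn -subn_eq0 -size_drop uk.
  rewrite k_n in obs *; rewrite stack_sum_end //.
  by case: (bs).
have kltn : (k < n)%N by rewrite -subn_gt0 -size_drop uk.
pose k' := Ordinal kltn.
have jE : tnth (in_tuple u) k' = j.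
  by rewrite (tnth_nth j) /= -[k]addn0 -nth_drop uk.
have uk1 : drop k.+1 u = w by rewrite -add1n -drop_drop uk /= drop0.
have s1 : subword [set k'] = [:: j].
  by rewrite -[[set k']]setU0 subword_setU1 ?sub0set // /subword enum_set0 jE.
have obs1 := ordered_stack_le (leqnSn k) obs.
rewrite (@stack_sum_step _ _ _ bs k' obs) /=.
rewrite !(IH k.+1) //; last exact: (ordered_stack_push (k := k')).
rewrite s1 /=; congr (_ + _ + _).
  by congr (stack_moment _ _ _ (_ :: _)); apply: funext => v; rewrite /open_block s1.
case: bs obs obs1 => [//|b bs] obs obs1 /=.
have [_ bsk _] := obs.
have sb : subword (k' |: b) = rcons (subword b) j.
  by rewrite subword_setU1 ?jE // bsk // mem_head.
rewrite !(IH k.+1) //=; last 2 first.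
- exact: ordered_stack_pop obs1.
- exact: (ordered_stack_grow (k := k')).
rewrite sb; congr (_ + _); last by rewrite /open_block cats1.
congr (stack_moment _ _ _ (_ :: _)); apply: funext => v.
by rewrite /open_block sb cat_rcons.
Qed.

Definition convex B : bool :=
  [forall i in B, forall j in B, forall k : 'I_n, (i <= k <= j)%N ==> (k \in B)].

Lemma convexP B :
  reflect {in B &, forall i j k : 'I_n, (i <= k <= j)%N -> k \in B} (convex B).
Proof.
apply: (iffP forall_inP) => [cvx i j Bi Bj k ikj|cvx i Bi].
  by have /forall_inP/(_ j Bj)/forallP/(_ k)/implyP := cvx i Bi; apply.
apply/forall_inP => j Bj; apply/forallP => k; apply/implyP; exact: cvx.
Qed.

(** The weight that makes the sum over noncrossing partitions see only
    interval partitions. *)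
Definition convex_weight B : K := if convex B then kappa (subword B) else 0.

(** Between two elements of an interval block there is no room for an
    element of another block. *)
Lemma interval_noncrossing (pi : {set {set 'I_n}}) :
  is_interval_partition pi -> is_noncrossing_partition pi.
Proof.
move=> /andP[part /forall_inP cvx]; apply/andP; split=> //.
apply/(noncrossingP pi) => B B' piB piB'; apply: contra.
move=> /crossingP[i [j [k [l [[Bi B'j Bk _] [ij jk _]]]]]].
have Bj : j \in B.
  by apply: (convexP _ (cvx B piB)) Bi Bk _ _; rewrite (ltnW ij) (ltnW jk).
have triv := partition_trivIset part.
by rewrite -(def_pblock triv piB Bj) (def_pblock triv piB' B'j).
Qed.

Lemma interval_sum_convex_weight :
  \sum_(pi : {set {set 'I_n}} | is_interval_partition pi)
     \prod_(B in pi) kappa (subword B) = stack_sum convex_weight [::] 0.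
Proof.
rewrite stack_sum_start.
rewrite [RHS](bigID (fun pi : {set {set 'I_n}} => [forall B in pi, convex B])) /=.
rewrite [X in _ = _ + X]big1 ?addr0.
  apply: eq_big => [pi|pi /andP[_ /forall_inP cvx]].
    apply/idP/andP => [ivl|[/andP[part _] cvx]]; last exact/andP.
    by split; [apply: interval_noncrossing | case/andP: ivl].
  apply: eq_bigr => B piB; have cvxB : convex B := cvx B piB.
  by rewrite /convex_weight cvxB.
move=> pi /andP[_]; rewrite negb_forall => /existsP[B]; rewrite negb_imply.
by move=> /andP[piB /negPf cvx]; rewrite (bigD1 B) //= /convex_weight cvx mul0r.
Qed.

(** A block with an element [x] below the position [k] must still receive an
    element beyond [k]; if it skipped [k] it is not convex. *)
Lemma skipped_stack_sum bs (x k : 'I_n) :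
  has (fun b => x \in b) bs -> {in bs, forall b : {set 'I_n}, x \in b -> k \notin b} ->
  (x < k)%N -> stack_sum convex_weight bs k.+1 = 0.
Proof.
move=> xbs kbs xk; apply: big1 => pi /completesP[part _ tr out].
have xpi : x \in cover pi by rewrite (cover_partition part) in_stack_ground xbs.
have piB := pblock_mem xpi; move: xpi piB; rewrite -mem_pblock.
set B := pblock pi x => xB piB; have [y yB ky] := out B piB.
have kB : k \notin B.
  apply/negP => kB.
  have xT : x \in B :&: below k.+1 by rewrite !inE xB ltnS ltnW.
  have kT : k \in B :&: below k.+1 by rewrite !inE kB ltnS /=.
  have := tr B piB; rewrite inE => /orP[/eqP e|bbs]; first by rewrite e inE in xT.
  by have := kbs _ bbs xT; rewrite kT.
rewrite (bigD1 B) //= /convex_weight; case: convexP => [cvx|_]; last by rewrite mul0r.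
by case/negP: kB; apply: cvx xB yB _ _; rewrite (ltnW xk) (ltnW ky).
Qed.

Definition segment (a k : nat) : {set 'I_n} := [set x : 'I_n | (a <= x < k)%N].

Lemma convex_segment a k : convex (segment a k).
Proof.
apply/convexP => i j; rewrite !inE => /andP[ai _] /andP[_ jk] m /andP[im mj].
by rewrite inE (leq_trans ai im) (leq_ltn_trans mj jk).
Qed.

Lemma ordered_segment a k :
  (a < k <= n)%N -> ordered_stack [:: segment a k] k.
Proof.
move=> /andP[ak kn]; split=> //= b; rewrite inE => /eqP->.
  by apply/set0Pn; exists (Ordinal (leq_trans ak kn)); rewrite inE /= leqnn.
by apply/subsetP => x; rewrite !inE => /andP[].
Qed.

(** For interval partitions the stack is empty or consists of one segment
    ending just below the current position. *)
Lemma interval_stack_sum (k : nat) :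
  (k <= n)%N ->
  stack_sum convex_weight [::] k = stack_moment false kappa (drop k u) [::] /\
  forall a, (a < k)%N ->
    stack_sum convex_weight [:: segment a k] k =
      stack_moment false kappa (drop k u) [:: open_block (segment a k)].
Proof.
move=> kn; move uk : (drop k u) => w; elim: w k kn uk => [|j w IH] k kn uk.
  have k_n : k = n.
    by apply/eqP; rewrite eqn_leq kn -subn_eq0 -size_drop uk.
  rewrite k_n; split=> [|a an]; rewrite stack_sum_end //.
  by apply: ordered_segment; rewrite an leqnn.
have kltn : (k < n)%N by rewrite -subn_gt0 -size_drop uk.
pose k' := Ordinal kltn.
have jE : tnth (in_tuple u) k' = j.
  by rewrite (tnth_nth j) /= -[k]addn0 -nth_drop uk.
have uk1 : drop k.+1 u = w by rewrite -add1n -drop_drop uk /= drop0.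
have s1 : subword [set k'] = [:: j].
  by rewrite -[[set k']]setU0 subword_setU1 ?sub0set // /subword enum_set0 jE.
have k1 : [set k'] = segment k k.+1.
  by apply/setP => x; rewrite !inE ltnS -eqn_leq eq_sym.
have [IH0 IH1] := IH k.+1 kltn uk1.
have w1 : convex_weight [set k'] = kappa [:: j].
  by rewrite /convex_weight s1 k1 convex_segment.
split=> [|a ak].
  rewrite (@stack_sum_step _ _ _ _ k' (ordered_stack_nil k)) /= w1.
  rewrite k1 IH1 // IH0 -k1; congr (_ + _ + _).
  by congr (stack_moment _ _ _ [:: _]); apply: funext => v; rewrite /open_block s1.
have ord : ordered_stack [:: segment a k] k by apply: ordered_segment; rewrite ak.
have kseg : k' |: segment a k = segment a k.+1.
  apply/setP => x; rewrite !inE ltnS [(x <= k)%N]leq_eqVlt -val_eqE /=.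
  by case: eqP => [->|] //=; rewrite (ltnW ak).
have sb : subword (segment a k.+1) = rcons (subword (segment a k)) j.
  by rewrite -kseg subword_setU1 ?jE //; apply/subsetP => x; rewrite !inE => /andP[].
have aord : (a < n)%N := ltn_trans ak kltn.
pose a' := Ordinal aord.
(* Leaving the open segment aside, with the position k closed at once or
   opening a block of its own, condemns the segment. *)
have skip : stack_sum convex_weight [:: segment a k] k.+1 = 0 /\
            stack_sum convex_weight [:: [set k']; segment a k] k.+1 = 0.
  split; apply: (@skipped_stack_sum _ a' k') => //=; rewrite ?inE /= ?leqnn ?ak ?orbT //.
    by move=> b; rewrite inE => /eqP->; rewrite !inE /= ltnn andbF.
  move=> b; rewrite !inE => /orP[]/eqP->; rewrite !inE -?val_eqE /= ?ltnn ?andbF //.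
  by rewrite (ltn_eqF ak).
rewrite (@stack_sum_step _ _ _ _ k' ord) /= !(proj1 skip) !(proj2 skip).
rewrite kseg IH1 ?IH0; last by rewrite ltnS ltnW.
rewrite mulr0 addr0 {1}/convex_weight convex_segment sb; congr (_ + (_ + _)).
  congr (stack_moment _ _ _ [:: _]); apply: funext => v.
  by rewrite /open_block sb cat_rcons.
by rewrite /open_block cats1.
Qed.

Lemma noncrossing_moment :
  \sum_(pi : {set {set 'I_n}} | is_noncrossing_partition pi)
     \prod_(B in pi) kappa (subword B) = stack_moment true kappa u [::].
Proof.
by rewrite -stack_sum_start (@noncrossing_stack_sum 0) ?drop0.
Qed.

Lemma interval_moment :
  \sum_(pi : {set {set 'I_n}} | is_interval_partition pi)
     \prod_(B in pi) kappa (subword B) = stack_moment false kappa u [::].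
Proof.
by rewrite interval_sum_convex_weight (interval_stack_sum (leq0n n)).1 drop0.
Qed.

End PartitionMoments.

(** * Vacuum expectations on the full Fock space *)

Section FockFunctional.
Variables (K : comNzRingType) (d : nat).
Implicit Types (T : 'I_d -> 'M[K]_d) (g c : 'I_d -> 'I_d -> K) (w s u : seq 'I_d).

(** The coefficient of e_s in X_w applied to the empty word, computed from
    the left: the transposed operators act on the coefficient functionals,
    so annihilation lengthens [s] and creation shortens it. *)
Fixpoint fock (alpha : K) T g w s : K :=
  if w is j :: w' then
    if s is i :: s' then
      (i == j)%:R * fock alpha T g w' s'
      + \sum_k T j i k * fock alpha T g w' (k :: s')
      + g j i * fock alpha T g w' [:: j, i & s']
    else alpha * fock alpha T g w' [:: j]
  else (nilp s)%:R.

(** With alpha = 0 the only paths that survive are those that reach the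
    empty word at the very end.  Hence this is the cumulant, up to the
    factor alpha of the first annihilation. *)
Definition fock_cumulant T c u : K := if u is i :: v then fock 0 T c v [:: i] else 0.

Lemma eq_fock alpha T T' g g' w s :
  (forall i j k, T i j k = T' i j k) -> (forall i j, g i j = g' i j) ->
  fock alpha T g w s = fock alpha T' g' w s.
Proof.
move=> eT eg; elim: w s => [//|j w IH] [|i s] /=; rewrite !IH // eg.
by congr (_ + _ + _); apply: eq_bigr => k _; rewrite IH eT.
Qed.

Lemma fock0_nilp T g v : fock 0 T g v [::] = (nilp v)%:R.
Proof. by case: v => //= j v; rewrite mul0r. Qed.

(** The word [flatten ss] is cut into the open blocks of a stack.  Where the
    cuts are does not show in the Fock space: opening a block with the
    letter [j] on top of [i :: s], and appending [j] to that block through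
    the weight [c j i], both lead to [j :: i :: s].  Hence the weights alpha
    (if nesting is allowed) and [c j i] add up. *)
Lemma fock_stack_moment (nest : bool) alpha T c w (ss : seq (seq 'I_d)) :
  all (fun s => ~~ nilp s) ss -> nest || (size ss <= 1)%N ->
  fock alpha T (fun i j => nest%:R * alpha + c i j) w (flatten ss) =
    stack_moment nest (fun u => alpha * fock_cumulant T c u) w
      [seq (fun v => fock 0 T c v s) | s <- ss].
Proof.
pose L s : seq 'I_d -> K := fun v => fock 0 T c v s.
pose g i j := nest%:R * alpha + c i j; pose ka u := alpha * fock_cumulant T c u.
move=> ssN nss; change (fock alpha T g w (flatten ss) =
                        stack_moment nest ka w [seq L s | s <- ss]).
have kaj j : ka [:: j] = 0 by rewrite /ka /= mulr0.
elim: w ss ssN nss => [|j w IH] [|[//|i s] ss] //= ssN nss.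
  have /= := IH [:: [:: j]] isT; rewrite orbT => -> //.
  by rewrite kaj mul0r !addr0; apply/esym/stack_momentZ.
pose mom fs := stack_moment nest ka w fs.
have mom_push s' : ~~ nilp s' ->
    mom (L s' :: [seq L s | s <- ss]) = fock alpha T g w (s' ++ flatten ss).
  by move=> s'0; rewrite /mom (IH (s' :: ss)) //= s'0.
have mom_ss : mom [seq L s | s <- ss] = fock alpha T g w (flatten ss).
  rewrite (IH ss) //; case: (nest) nss => //=; rewrite ltnS leqn0.
  by case: (ss).
(* When s is empty its functional is the indicator of the empty word, which
   closes the block instead of keeping it open. *)
have mom_pop : mom (L s :: [seq L s | s <- ss]) + L s [::] * mom [seq L s | s <- ss]
    = fock alpha T g w (s ++ flatten ss).
  case: s {ssN} => [|i' s]; last by rewrite {2}/L mul0r addr0 mom_push.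
  rewrite mom_ss {2}/L mul1r /mom stack_moment0 ?add0r // => v v0.
  by rewrite /L fock0_nilp (negPf v0).
have -> : tail_functional (L (i :: s)) j = fun v =>
    ((i == j)%:R * L s v + \sum_k T j i k * L (k :: s) v) + c j i * L [:: j, i & s] v.
  by [].
rewrite -/mom.
rewrite !stack_momentD !stack_momentZ stack_moment_sum.
have -> : L (i :: s) [:: j] = (i == j)%:R * L s [::].
  rewrite /L /= mulr0 addr0 big1 ?addr0 // => k _.
  by rewrite mulr0.
have -> : \sum_k stack_moment nest ka w
      ((fun v => T j i k * L (k :: s) v) :: [seq L s0 | s0 <- ss]) =
    \sum_k T j i k * fock alpha T g w (k :: s ++ flatten ss).
  by apply: eq_bigr => k _; rewrite stack_momentZ -(mom_push (k :: s)).
have -> : (if nest || nilp (L (i :: s) :: [seq L s0 | s0 <- ss]) then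
      alpha * stack_moment nest ka w
        [:: (fun v => fock_cumulant T c (j :: v)), L (i :: s) & [seq L s0 | s0 <- ss]]
      + ka [:: j] * stack_moment nest ka w (L (i :: s) :: [seq L s0 | s0 <- ss])
    else 0) = nest%:R * alpha * fock alpha T g w [:: j, i & s ++ flatten ss].
  case: (nest) IH => IH /=; last by rewrite !mul0r.
  rewrite kaj mul0r addr0 mul1r.
  by have /= -> := IH [:: [:: j], i :: s & ss] ssN isT.
rewrite -(mom_push [:: j, i & s]) // -mom_pop /g /mom.
ring.
Qed.

Lemma fock_moment (nest : bool) alpha T c u :
  fock alpha T (fun i j => nest%:R * alpha + c i j) u [::] =
    stack_moment nest (fun u => alpha * fock_cumulant T c u) u [::].
Proof. by have := @fock_stack_moment nest alpha T c u [::] isT; apply; rewrite orbT. Qed.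

(** A path from the empty word to [s] has [size s] more creations than
    annihilations, so [size w - size s] is the number of preservations plus
    twice the number of annihilations. *)
Lemma fock_dilation (r alpha : K) T g w s :
  r ^+ size w * fock alpha T g w s =
  r ^+ size s * fock (r ^+ 2 * alpha) (fun i => r *: T i) (fun i j => r ^+ 2 * g i j) w s.
Proof.
elim: w s => [|j w IH] [|i s] /=; rewrite ?mulr0 ?mulr1 //.
  transitivity (r * alpha * (r ^+ size w * fock alpha T g w [:: j])).
    by rewrite exprS; ring.
  by rewrite IH /= expr1; ring.
rewrite [r ^+ (size w).+1]exprS [r ^+ (size s).+1]exprS !mulrDr; congr (_ + _ + _).
- transitivity (r * (i == j)%:R * (r ^+ size w * fock alpha T g w s)); first by ring.
  by rewrite IH; ring.
- rewrite !mulr_sumr; apply: eq_bigr => k _; rewrite mxE.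
  transitivity (r * T j i k * (r ^+ size w * fock alpha T g w (k :: s))); first by ring.
  by rewrite IH /= [r ^+ (size s).+1]exprS; ring.
- transitivity (r * g j i * (r ^+ size w * fock alpha T g w [:: j, i & s])); first by ring.
  by rewrite IH /= [r ^+ (size s).+2]exprS [r ^+ (size s).+1]exprS; ring.
Qed.

Lemma fock_letter_nil alpha T g (k : 'I_d) : fock alpha T g [:: k] [::] = 0.
Proof. by rewrite /= mulr0. Qed.

Lemma fock_letter alpha T g (k b : 'I_d) s :
  fock alpha T g [:: k] (b :: s) = ((b == k) && nilp s)%:R.
Proof.
rewrite /= mulr0 addr0 big1 ?addr0 => [|l _]; last by rewrite mulr0.
by rewrite -natrM mulnb.
Qed.

Lemma sum_pred1_mul (F : 'I_d -> K) x (e : bool) :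
  \sum_k F k * ((k == x) && e)%:R = F x * e%:R.
Proof.
rewrite (bigD1 x) //= eqxx big1 ?addr0 // => k /negPf->.
by rewrite mulr0.
Qed.

(** Thus x_i x_j - sum_k (T_i)_kj x_k - delta_ij alpha sends the empty word
    to e_(i j). *)
Lemma fock_letters alpha T g (i j : 'I_d) s :
  fock alpha T g [:: i; j] s - \sum_k T i k j * fock alpha T g [:: k] s
  - (i == j)%:R * alpha * (nilp s)%:R = (s == [:: i; j])%:R.
Proof.
case: s => [|a s].
  rewrite big1 => [|k _]; last by rewrite fock_letter_nil mulr0.
  have -> : fock alpha T g [:: i; j] [::] = alpha * fock alpha T g [:: j] [:: i] by [].
  by rewrite fock_letter /= andbT; ring.
have -> : \sum_k T i k j * fock alpha T g [:: k] (a :: s) = T i a j * (nilp s)%:R.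
  rewrite -(sum_pred1_mul (T i ^~ j)); apply: eq_bigr => k _.
  by rewrite fock_letter eq_sym.
have -> : fock alpha T g [:: i; j] (a :: s) = (a == i)%:R * fock alpha T g [:: j] s
    + \sum_k T i a k * fock alpha T g [:: j] (k :: s)
    + g i a * fock alpha T g [:: j] [:: i, a & s] by [].
have -> : \sum_k T i a k * fock alpha T g [:: j] (k :: s) = T i a j * (nilp s)%:R.
  by rewrite -sum_pred1_mul; apply: eq_bigr => k _; rewrite fock_letter.
rewrite fock_letter andbF !mulr0 addr0 addrK subr0 eqseq_cons -mulnb natrM.
congr (_ * _); case: s => [|b s]; first by rewrite fock_letter_nil.
by rewrite fock_letter eqseq_cons; case: s.
Qed.

End FockFunctional.

(** * Convolution powers and free Meixner functionals *)

Section CumulantPowers.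
Context {R : realType} {d : nat}.
Local Notation K := R[i].
Local Notation A := (ncpoly R d).
Implicit Types (phi : {scalar A}) (T : 'I_d -> 'M[K]_d) (c g : 'I_d -> 'I_d -> K).

(** In the free case the weights [g] exceed [c] by alpha, the weight of
    opening a nested block. *)
Lemma fock_is_free_cumulant phi (alpha : K) T c :
  (forall u, phi (ncword u) = fock alpha T (fun i j => alpha + c i j) u [::]) ->
  is_cumulant is_noncrossing_partition phi (fun u => alpha * fock_cumulant T c u).
Proof.
move=> phiE; split=> [|u _]; first by rewrite /= mulr0.
rewrite phiE (noncrossing_moment (fun u => alpha * fock_cumulant T c u)) -fock_moment.
by apply: eq_fock => // i j; rewrite mul1r.
Qed.

Lemma fock_is_boolean_cumulant phi (alpha : K) T c :
  (forall u, phi (ncword u) = fock alpha T c u [::]) ->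
  is_cumulant is_interval_partition phi (fun u => alpha * fock_cumulant T c u).
Proof.
move=> phiE; split=> [|u _]; first by rewrite /= mulr0.
rewrite phiE (interval_moment (fun u => alpha * fock_cumulant T c u)) -fock_moment.
by apply: eq_fock => // i j; rewrite mul0r add0r.
Qed.

Lemma free_power_fock (t : R) phi (alpha : K) T c :
  (forall u, phi (ncword u) = fock alpha T (fun i j => alpha + c i j) u [::]) ->
  forall u, free_power t phi (ncword u) =
    fock (t%:C%C * alpha) T (fun i j => t%:C%C * alpha + c i j) u [::].
Proof.
move=> /fock_is_free_cumulant phiE u.
have [psi1 /(_ _ phiE)[_ psiE]] := free_powerP t phi.
have [->|u0] := eqVneq u [::]; first by rewrite ncword_nil psi1.
rewrite psiE // (noncrossing_moment (fun u => t%:C%C * (alpha * fock_cumulant T c u))).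
have -> : (fun u => t%:C%C * (alpha * fock_cumulant T c u)) =
          (fun u => t%:C%C * alpha * fock_cumulant T c u).
  by apply: funext => v; rewrite mulrA.
rewrite -fock_moment; apply: eq_fock => // i j; by rewrite mul1r.
Qed.

Lemma boolean_power_fock (t : R) phi (alpha : K) T g :
  (forall u, phi (ncword u) = fock alpha T g u [::]) ->
  forall u, boolean_power t phi (ncword u) = fock (t%:C%C * alpha) T g u [::].
Proof.
move=> /fock_is_boolean_cumulant phiE u.
have [psi1 /(_ _ phiE)[_ psiE]] := boolean_powerP t phi.
have [->|u0] := eqVneq u [::]; first by rewrite ncword_nil psi1.
rewrite psiE // (interval_moment (fun u => t%:C%C * (alpha * fock_cumulant T g u))).
have -> : (fun u => t%:C%C * (alpha * fock_cumulant T g u)) =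
          (fun u => t%:C%C * alpha * fock_cumulant T g u).
  by apply: funext => v; rewrite mulrA.
rewrite -fock_moment; apply: eq_fock => // i j; by rewrite mul0r add0r.
Qed.

(** The free power moves alpha to 1 + t and every weight up by t; the
    Boolean power brings alpha back to 1 without touching the weights. *)
Lemma belinschi_nica_fock (t : R) phi T c : 0 <= t ->
  (forall u, phi (ncword u) = fock 1 T (fun i j => 1 + c i j) u [::]) ->
  forall u, belinschi_nica t phi (ncword u) =
    fock 1 T (fun i j => 1 + (t%:C%C + c i j)) u [::].
Proof.
move=> t0 phiE u.
rewrite (boolean_power_fock _ (free_power_fock _ phiE)).
have t1 : 1 + t != 0 by rewrite gt_eqF // ltr_pwDl.
have -> : ((1 + t)^-1)%:C%C * ((1 + t)%:C%C * 1) = 1 :> K.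
  by rewrite mulr1 -rmorphM mulVf.
by apply: eq_fock => // i j; rewrite mulr1 rmorphD rmorph1 addrA.
Qed.

Lemma dilation_fock (r : R) phi (alpha : K) T g :
  (forall u, phi (ncword u) = fock alpha T g u [::]) ->
  forall u, dilation r phi (ncword u) =
    fock ((r ^+ 2)%:C%C * alpha) (fun i => r%:C%C *: T i)
         (fun i j => (r ^+ 2)%:C%C * g i j) u [::].
Proof.
move=> phiE u; apply: etrans (word_functionalE _ u) _; rewrite phiE fock_dilation mul1r.
by rewrite rmorphXn.
Qed.

(** The coefficient of e_s in P(X) applied to the empty word, for
    polynomials P. *)
Definition bra (alpha : K) T g (s : seq 'I_d) : {scalar A} :=
  word_functional (fun w => fock alpha T g w s).

Lemma braE alpha T g s w : bra alpha T g s (ncword w) = fock alpha T g w s.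
Proof. exact: word_functionalE. Qed.

Lemma bra_mulX alpha T g s j P :
  bra alpha T g s (ncX j * P) = \sum_(u <- msupp P) P@_u * fock alpha T g (j :: u) s.
Proof.
rewrite {1}(ncpolyE P) mulr_sumr linear_sum; apply: eq_bigr => u _.
by rewrite ncmulZr linearZ /= -ncword_cons braE.
Qed.

Lemma bra_nil_mulX alpha T g j P :
  bra alpha T g [::] (ncX j * P) = alpha * bra alpha T g [:: j] P.
Proof.
rewrite bra_mulX /bra /= /word_functional mulr_sumr; apply: eq_bigr => u _ /=.
by rewrite mulrCA.
Qed.

Lemma bra_cons_mulX alpha T g i s j P :
  bra alpha T g (i :: s) (ncX j * P) =
    (i == j)%:R * bra alpha T g s P
    + \sum_k T j i k * bra alpha T g (k :: s) P
    + g j i * bra alpha T g [:: j, i & s] P.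
Proof.
rewrite bra_mulX /bra /= /word_functional.
rewrite !mulr_sumr.
under [X in _ + X + _]eq_bigr do rewrite mulr_sumr.
rewrite exchange_big /= -!big_split /=; apply: eq_bigr => u _.
rewrite !mulrDr mulr_sumr.
under [X in _ + X + _ = _]eq_bigr do rewrite mulrCA.
by rewrite [_ * (g j i * _)]mulrCA [_ * ((i == j)%:R * _)]mulrCA.
Qed.

Lemma bra1 alpha T g s : bra alpha T g s 1 = (nilp s)%:R.
Proof. by rewrite -ncword_nil braE. Qed.

Lemma meixner_poly_step (C : 'M[K]_(d * d)) T i j v (f : {scalar A}) :
  f (meixner_poly C T [:: i, j & v]) =
    f (ncX i * meixner_poly C T (j :: v))
    - \sum_k T i k j * f (meixner_poly C T (k :: v))
    - (i == j)%:R * meixner_weight C i v * f (meixner_poly C T v).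
Proof.
rewrite meixner_polyE [f (_ + _ *: _)]linearD linearD linearZ linear_sum /=.
under eq_bigr do rewrite linearZ /=.
by rewrite addrAC !addrK.
Qed.

(** The Meixner polynomials create the basis: P_v(X) sends the empty word to
    e_v.  The statement for [j :: v] with all [j] is proved along with the
    one for [v], as the recursion for P involves both lengths. *)
Lemma bra_meixner_poly (C : 'M[K]_(d * d)) T v s :
  bra 1 T (fun i j => 1 + diag_coef C i j) s (meixner_poly C T v) = (s == v)%:R.
Proof.
set g := fun i j => _.
suff [] : (forall s, bra 1 T g s (meixner_poly C T v) = (s == v)%:R) /\
  (forall j s, bra 1 T g s (meixner_poly C T (j :: v)) = (s == j :: v)%:R) by [].
elim: v {s} => [|j v [IH1 IH2]].
  split=> [s|j s]; first by rewrite meixner_poly_nil bra1; case: s.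
  rewrite meixner_poly1 -[ncX j]mulr1; case: s => [|i s].
    by rewrite bra_nil_mulX bra1 mulr0.
  rewrite bra_cons_mulX !bra1 mulr0 addr0 big1 ?addr0 => [|k _].
    by rewrite eqseq_cons -natrM mulnb; case: s.
  by rewrite bra1 mulr0.
split=> [//|i s].
rewrite meixner_poly_step IH1.
under eq_bigr do rewrite IH2.
case: s => [|a s].
  rewrite bra_nil_mulX IH2 mul1r big1 => [|k _]; last by rewrite mulr0.
  rewrite subr0 !eqseq_cons; case: v {IH1 IH2} => [|b v] /=.
    by rewrite andbT mulr1 mulr1 eq_sym subrr.
  by rewrite andbF mulr0 subr0.
rewrite bra_cons_mulX !IH2.
have -> : \sum_k T i a k * bra 1 T g (k :: s) (meixner_poly C T (j :: v)) =
    T i a j * (s == v)%:R.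
  by rewrite -sum_pred1_mul; apply: eq_bigr => k _; rewrite IH2 eqseq_cons.
have -> : \sum_k T i k j * (a :: s == k :: v)%:R = T i a j * (s == v)%:R.
  by rewrite -(sum_pred1_mul (T i ^~ j)); apply: eq_bigr => k _; rewrite eqseq_cons eq_sym.
rewrite !eqseq_cons.
have [asv|] := eqVneq (a :: s) v; last first.
  by rewrite andbF /= !mulr0 addr0 addrK subr0 -natrM mulnb.
by rewrite -asv /= andbT mulr1 /g -natrM mulnb; ring.
Qed.

Lemma free_meixner_fock (C : 'M[K]_(d * d)) T u :
  free_meixner C T (ncword u) = fock 1 T (fun i j => 1 + diag_coef C i j) u [::].
Proof.
rewrite -braE; apply: free_meixner_unique (free_meixnerP C T) _ _; split.
  by rewrite /unital bra1.
by move=> v v0; rewrite bra_meixner_poly eq_sym (negPf v0).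
Qed.

End CumulantPowers.

(** * Positivity and membership in the Meixner class *)

Section States.
Context {R : realType} {d : nat}.
Local Notation K := R[i].
Local Notation A := (ncpoly R d).
Implicit Types (phi : {scalar A}) (T : 'I_d -> 'M[K]_d) (g : 'I_d -> 'I_d -> K).

(** The Meixner polynomial of the word i j for a covariance alpha other than
    1. *)
Definition degree2_poly (alpha : K) T (i j : 'I_d) : A :=
  ncword [:: i; j] - \sum_k T i k j *: ncword [:: k] - ((i == j)%:R * alpha) *: 1.

Lemma bra_degree2_poly alpha T g i j s :
  bra alpha T g s (degree2_poly alpha T i j) = (s == [:: i; j])%:R.
Proof.
have E (f : {scalar A}) : f (degree2_poly alpha T i j) =
    f (ncword [:: i; j]) - \sum_k T i k j * f (ncword [:: k])
    - (i == j)%:R * alpha * f 1.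
  rewrite [f _]linearB linearB linearZ linear_sum /=.
  by under eq_bigr do rewrite linearZ /=.
rewrite E bra1 braE; under eq_bigr do rewrite braE.
exact: fock_letters.
Qed.

Lemma mcoeff_ncword (v : seq 'I_d) u : (ncword v : A)@_u = (FMonom v == u)%:R.
Proof. by rewrite ncwordE mcoeffU1. Qed.

Lemma mcoeff_degree2_poly alpha T i j u :
  (degree2_poly alpha T i j)@_u = (FMonom [:: i; j] == u)%:R
    - \sum_k T i k j * (FMonom [:: k] == u)%:R
    - (i == j)%:R * alpha * (FMonom [::] == u)%:R.
Proof.
rewrite /degree2_poly -ncword_nil mcoeffB mcoeffB mcoeffZ raddf_sum /=.
rewrite [(ncword [:: i; j])@_u]mcoeff_ncword [(ncword [::])@_u]mcoeff_ncword.
by under eq_bigr do rewrite mcoeffZ mcoeff_ncword.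
Qed.

(** For P the polynomial that creates e_(i j), the only word u of length at
    most 2 for which x_(rev u) takes e_(i j) back to the empty word is i j,
    with weight t g_ij.  As i j has coefficient 1 in P, phi (P^* P) = t
    g_ij. *)
Lemma fock_state_ge0 phi (t : R) T g : 0 < t -> is_state phi ->
  (forall u, phi (ncword u) = fock t%:C%C T g u [::]) -> forall i j, 0 <= g i j.
Proof.
move=> t0 [_ _ pos] phiE i j; pose P := degree2_poly t%:C%C T i j.
have phi_bra : phi =1 bra t%:C%C T g [::].
  by apply: eq_on_words => u; rewrite phiE braE.
have supp u : u \in msupp P -> (size (u : seq 'I_d) <= 2)%N.
  apply: contraTT; rewrite -ltnNge => u2; rewrite -mcoeff_eq0 /P.
  have neq (v : seq 'I_d) : (size v <= 2)%N -> (FMonom v == u) = false.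
    by move=> v2; apply/eqP => vu; rewrite -vu ltnNge v2 in u2.
  rewrite mcoeff_degree2_poly big1 => [|k _]; last by rewrite neq ?mulr0.
  by rewrite !neq // mulr0 !subr0.
have coefij : P@_(FMonom [:: i; j]) = 1.
  have neq (v : seq 'I_d) : (size v < 2)%N -> (FMonom v == FMonom [:: i; j]) = false.
    by move=> v2; apply/negbTE; rewrite fmP; apply: contraTneq v2 => /= ->.
  rewrite mcoeff_degree2_poly big1 => [|k _]; last by rewrite neq ?mulr0.
  by rewrite eqxx neq // mulr0 !subr0.
have act u : (size u <= 2)%N ->
    phi (ncword (rev u) * P) = t%:C%C * g i j * (u == [:: i; j])%:R.
  rewrite phi_bra; case: u => [|b [|a [|//]]] _.
  - by rewrite ncword_nil mul1r bra_degree2_poly mulr0.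
  - rewrite ncword_cons ncword_nil mulr1 bra_nil_mulX bra_degree2_poly.
    by rewrite !eqseq_cons andbF !mulr0.
  have -> : ncword (rev [:: b; a]) * P = ncX a * (ncX b * P).
    by rewrite (ncword_cons a [:: b]) [ncword [:: b]]big_seq1; apply/esym/mulrA.
  rewrite bra_nil_mulX bra_cons_mulX.
  rewrite !bra_degree2_poly big1 => [|k _].
    rewrite mulr0 !add0r -mulrA !eqseq_cons !andbT andbC.
    have [->|_] := eqVneq b i; last by rewrite andbF !mulr0.
    by have [->|_] := eqVneq a j; rewrite ?mulr0.
  by rewrite bra_degree2_poly eqseq_cons andbF mulr0.
have phi_square : phi (ncadj P * P) = t%:C%C * g i j.
  rewrite /ncadj mulr_suml linear_sum /=.
  transitivity (\sum_(u <- msupp P)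
      (P@_u)^* * (t%:C%C * g i j * (u == FMonom [:: i; j])%:R)).
    rewrite [LHS]big_seq [RHS]big_seq; apply: eq_bigr => u uP.
    have -> : << (P@_u)^* *g FMonom (rev u) >> = (P@_u)^* *: ncword (rev u) :> A.
      rewrite ncwordE; apply/malgP => w.
      by rewrite mcoeffZ mcoeffU1 mcoeffU mulr_natr.
    by rewrite -scalerAl linearZ /= act ?supp.
  rewrite (bigD1_seq (FMonom [:: i; j])) ?fset_uniq //=.
    rewrite coefij rmorph1 mul1r eqxx mulr1 big1_seq ?addr0 // => u /andP[/negPf-> _].
    by rewrite !mulr0.
  by rewrite -mcoeff_neq0 coefij oner_neq0.
by have := pos P; rewrite phi_square pmulr_rge0 // ltcR.
Qed.

Local Open Scope sesquilinear_scope.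

Lemma diag_psdmx n (M : 'M[K]_n) :
  is_diag_mx M -> psdmx M <-> forall k, 0 <= M k k.
Proof.
move=> /is_diag_mxP diag.
have form (v : 'rV[K]_n) :
    (v *m M *m v ^t* ) 0 0 = \sum_k v 0 k * (v 0 k)^* * M k k.
  rewrite !mxE; apply: eq_bigr => k _; rewrite !mxE (bigD1 k) //= big1 => [|l lk].
    by rewrite addr0 mulrAC.
  by rewrite diag ?mulr0.
split=> [psd k|M0 v].
  have := psd (delta_mx 0 k); rewrite form (bigD1 k) //= big1 => [|l lk].
    by rewrite !mxE !eqxx mul1r conjC1 mul1r addr0.
  by rewrite !mxE (negPf lk) andbF !mul0r.
by rewrite form; apply: sumr_ge0 => k _; rewrite mulr_ge0 // mul_conjC_ge0.
Qed.

Lemma diag_coef_affine (C : 'M[K]_(d * d)) (a b : K) i j :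
  diag_coef (a *: C + b%:M) i j = a * diag_coef C i j + b.
Proof. by rewrite /diag_coef !mxE eqxx mulr1n. Qed.

(** The commutation hypothesis survives since the new matrix is a polynomial
    in [C]. *)
Lemma meixner_data_affine (C : 'M[K]_(d * d)) T (a b r : R) :
  meixner_data C T -> (forall i j, 0 <= 1 + (a%:C%C * diag_coef C i j + b%:C%C)) ->
  meixner_data (a%:C%C *: C + (b%:C%C)%:M) (fun i => r%:C%C *: T i).
Proof.
move=> [herm diag _ comm] pos; split.
- move=> i; have /is_hermitianmxP := herm i; rewrite expr0 scale1r => hermi.
  apply/is_hermitianmxP; rewrite expr0 scale1r [in LHS]hermi.
  have rE : (r%:C%C)^* = r%:C%C :> K := conjc_real r.
  apply/matrixP => k l; rewrite !mxE -[in LHS]rE.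
  exact/esym/(rmorphM Num.conj).
- apply/is_diag_mxP => k l kl; rewrite !mxE -[k == l]val_eqE (negPf kl) mulr0n addr0.
  by move/is_diag_mxP: diag => ->; rewrite ?mulr0.
- apply/diag_psdmx => [|k].
    apply/is_diag_mxP => k l kl; rewrite !mxE -[k == l]val_eqE (negPf kl).
    rewrite !mulr0n add0r addr0.
    by move/is_diag_mxP: diag => ->; rewrite ?mulr0.
  case: (mxtens_indexP k) => i j.
  have := pos i j; rewrite -diag_coef_affine /diag_coef.
  by rewrite [X in _ -> 0 <= X]mxE [(1%:M : 'M_(_, _)) _ _]mxE eqxx.
- move=> i; have -> : (r%:C%C *: T i) *t 1%:M = r%:C%C *: (T i *t 1%:M) :> 'M[K]_(d * d).
    apply/matrixP => k l.
    case: (mxtens_indexP k) => k1 k2; case: (mxtens_indexP l) => l1 l2.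
    by rewrite [RHS]mxE !tensmxE !mxE mulrA.
  rewrite -scalemxAl -scalemxAr; congr (_ *: _).
  by rewrite mulmxDr mulmxDl -scalemxAr -scalemxAl comm scalar_mxC.
Qed.

Lemma meixner_diag_ge0 (C : 'M[K]_(d * d)) T i j :
  meixner_data C T -> 0 <= 1 + diag_coef C i j.
Proof.
case=> _ diag psd _.
have diag1 : is_diag_mx (1%:M + C).
  apply/is_diag_mxP => k l kl; rewrite !mxE -[k == l]val_eqE (negPf kl) add0r.
  by move/is_diag_mxP: diag => ->.
move/(diag_psdmx diag1): psd => /(_ (mxtens_index (i, j))).
by rewrite !mxE eqxx.
Qed.

Lemma fock_meixner_class phi (C : 'M[K]_(d * d)) T (a b r : R) :
  meixner_data C T -> (forall i j, 0 <= 1 + (a%:C%C * diag_coef C i j + b%:C%C)) ->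
  (forall u, phi (ncword u) = fock 1 (fun i => r%:C%C *: T i)
     (fun i j => 1 + (a%:C%C * diag_coef C i j + b%:C%C)) u [::]) ->
  in_meixner_class phi.
Proof.
move=> data pos phiE; do 2!eexists; split; first exact: meixner_data_affine data pos.
apply: eq_on_words => u; rewrite phiE free_meixner_fock; apply: eq_fock => // i j.
by rewrite diag_coef_affine.
Qed.

(** Dilating by t^(-1/2) divides the covariance t and the weights by t. *)
Lemma fock_meixner_class_upto_dilation phi (C : 'M[K]_(d * d)) T (t b : R) :
  meixner_data C T -> 0 < t -> (forall i j, 0 <= b%:C%C + diag_coef C i j) ->
  (forall u, phi (ncword u) = fock t%:C%C T (fun i j => b%:C%C + diag_coef C i j) u [::]) ->
  in_meixner_class_upto_dilation phi.
Proof.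
move=> data t0 pos phiE; have s0 : 0 < Num.sqrt t^-1 by rewrite sqrtr_gt0 invr_gt0.
have s2 : Num.sqrt t^-1 ^+ 2 = t^-1 by rewrite sqr_sqrtr // invr_ge0 ltW.
have E x : t^-1%:C%C * (b%:C%C + x) = 1 + (t^-1%:C%C * x + (t^-1 * b - 1)%:C%C) :> K.
  by rewrite rmorphB rmorphM rmorph1; ring.
exists (Num.sqrt t^-1) => //.
apply: (@fock_meixner_class _ C T t^-1 (t^-1 * b - 1) (Num.sqrt t^-1)) data _ _.
  by move=> i j; rewrite -E mulr_ge0 // ler0c invr_ge0 ltW.
move=> u; rewrite (dilation_fock _ phiE) s2 -rmorphM mulVf ?gt_eqF // rmorph1.
by apply: eq_fock => // i j; rewrite E.
Qed.

End States.

(** * The Meixner class *)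

Section MeixnerClass.
Context {R : realType} {d : nat}.
Local Notation K := R[i].
Implicit Types (phi : {scalar ncpoly R d}).

Lemma meixner_class_fock phi : in_meixner_class phi ->
  exists C T, meixner_data C T /\
    forall u, phi (ncword u) = fock 1 T (fun i j => 1 + diag_coef C i j) u [::].
Proof.
by move=> [C [T [data phiE]]]; exists C, T; split=> // u; rewrite phiE free_meixner_fock.
Qed.

Lemma boolean_power_meixner phi (t : R) :
  in_meixner_class phi -> 0 < t -> in_meixner_class_upto_dilation (boolean_power t phi).
Proof.
move=> /meixner_class_fock[C [T [data phiE]]] t0.
apply: (@fock_meixner_class_upto_dilation _ _ _ C T t 1 data t0) => [i j|u].
  by rewrite rmorph1; apply: meixner_diag_ge0 data.
by rewrite (boolean_power_fock _ phiE) mulr1; apply: eq_fock => // i j; rewrite rmorph1.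
Qed.

Lemma free_power_meixner phi (t : R) :
  in_meixner_class phi -> 0 < t -> 1 <= t \/ is_state (free_power t phi) ->
  in_meixner_class_upto_dilation (free_power t phi).
Proof.
move=> /meixner_class_fock[C [T [data phiE]]] t0 t1.
have powE u : free_power t phi (ncword u) =
    fock t%:C%C T (fun i j => t%:C%C + diag_coef C i j) u [::].
  rewrite (free_power_fock _ phiE) mulr1; apply: eq_fock => // i j.
apply: (@fock_meixner_class_upto_dilation _ _ _ C T t t) => // i j.
case: t1 => [t1|state]; last exact: fock_state_ge0 powE i j.
rewrite -[t%:C%C](subrK 1) -addrA addr_ge0 ?(meixner_diag_ge0 i j data) //.
by rewrite -(rmorph1 (real_complex R)) -rmorphB ler0c subr_ge0.
Qed.

Lemma belinschi_nica_meixner phi (t : R) :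
  in_meixner_class phi -> 0 <= t -> in_meixner_class (belinschi_nica t phi).
Proof.
move=> /meixner_class_fock[C [T [data phiE]]] t0.
have E x : 1 + (1%:C%C * x + t%:C%C) = 1 + (t%:C%C + x) :> K.
  by rewrite rmorph1 mul1r [t%:C%C + x]addrC.
apply: (@fock_meixner_class _ _ _ C T 1 t 1 data) => [i j|u].
  by rewrite E addrCA addr_ge0 ?ler0c // (meixner_diag_ge0 _ _ data).
rewrite (belinschi_nica_fock t0 phiE); apply: eq_fock => [i j k|i j].
  by rewrite mxE rmorph1 mul1r.
by rewrite E.
Qed.

Lemma belinschi_nica_free_meixner (C : 'M[K]_(d * d)) T (t : R) : 0 <= t ->
  belinschi_nica t (free_meixner C T) =1 free_meixner (t%:C%C%:M + C) T.
Proof.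
move=> t0; apply: eq_on_words => u.
rewrite (belinschi_nica_fock t0 (free_meixner_fock C T)) free_meixner_fock.
apply: eq_fock => // i j.
have -> : t%:C%C%:M + C = 1 *: C + t%:C%C%:M by rewrite scale1r addrC.
by rewrite diag_coef_affine mul1r [t%:C%C + _]addrC.
Qed.

End MeixnerClass.

Section OneVariable.
Context {R : realType}.
Local Notation K := R[i].

(** With g = 0 only the empty word and the one-letter word are reached, so
    the moments satisfy m_(n+2) = m_n + T m_(n+1); the atoms b and - 1 / b
    are the roots of x^2 = T x + 1 for T = b - 1 / b, and the weights of the
    law are those with m_0 = 1, m_1 = 0. *)
Lemma bernoulli_fock (b : R) (T : 'I_1 -> 'M[K]_1) : b != 0 ->
  T 0 0 0 = (b - b^-1)%:C%C ->
  forall u, bernoulli b (ncword u) = fock 1 T (fun _ _ => 0) u [::].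
Proof.
move=> b0 TE u.
pose m n : R := (1 + b ^+ 2)^-1 * b ^+ n + b ^+ 2 / (1 + b ^+ 2) * (- b^-1) ^+ n.
have b1 : 1 + b ^+ 2 != 0 by rewrite gt_eqF // ltr_pwDl // sqr_ge0.
have m0 : m 0 = 1 by rewrite /m !expr0; field.
have m1 : m 1 = 0 by rewrite /m !expr1; field; rewrite b1 b0.
have mSS n : m n.+2 = m n + (b - b^-1) * m n.+1.
  by rewrite /m !exprS; field; rewrite b1 b0.
have fockE w : fock 1 T (fun _ _ => 0) w [::] = (m (size w))%:C%C /\
               fock 1 T (fun _ _ => 0) w [:: 0] = (m (size w).+1)%:C%C.
  elim: w => [|j w [IH0 IH1]]; first by rewrite /= m0 m1.
  split; first by rewrite /= (ord1 j) IH1 mul1r.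
  rewrite [LHS]/= (ord1 j) eqxx mul1r mul0r addr0 big_ord1 IH0 TE.
  by rewrite IH1 -rmorphM -rmorphD -mSS.
by rewrite (fockE u).1; apply: word_functionalE.
Qed.

(** B_(1 + C) raises C = -1, where the weight g vanishes, to the given C. *)
Lemma meixner_from_bernoulli (phi : {scalar ncpoly R 1}) :
  in_meixner_class phi ->
  exists b t : R, [/\ b != 0, 0 <= t & phi =1 belinschi_nica t (bernoulli b)].
Proof.
move=> /meixner_class_fock[C [T [data phiE]]].
pose tau := complex.Re (T 0 0 0); pose t := 1 + complex.Re (diag_coef C 0 0).
have TE : T 0 0 0 = tau%:C%C.
  have [/(_ 0)/is_hermitianmxP + _ _ _] := data; rewrite expr0 scale1r.
  move=> /matrixP/(_ 0 0); rewrite !mxE /tau.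
  by case: (T 0 0 0) => x y [/eqP]; rewrite -addr_eq0 -mulr2n mulrn_eq0 => /eqP->.
have [t0 CE] : 0 <= t /\ 1 + diag_coef C 0 0 = t%:C%C.
  have := meixner_diag_ge0 0 0 data; rewrite lecE /t.
  case: (diag_coef C 0 0) => x y /=; rewrite add0r => /andP[/eqP -> ?].
  by split=> //; rewrite rmorphD rmorph1.
(* The positive root of x^2 = tau x + 1. *)
pose b := (tau + Num.sqrt (tau ^+ 2 + 4)) / 2.
have sq : Num.sqrt (tau ^+ 2 + 4) ^+ 2 = tau ^+ 2 + 4.
  by rewrite sqr_sqrtr // addr_ge0 ?sqr_ge0.
have b_gt0 : 0 < b.
  rewrite /b divr_gt0 //; have [tau0|tau0] := leP 0 tau.
    by rewrite ltr_wpDl // sqrtr_gt0 ltr_wpDl ?sqr_ge0.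
  rewrite -ltrBlDl sub0r -[- tau]ger0_norm ?oppr_ge0 1?ltW // -sqrtr_sqr sqrrN.
  by rewrite ltr_sqrt ?ltrDl // ltr_wpDl ?sqr_ge0.
have b0 : b != 0 by rewrite gt_eqF.
have bE : b - b^-1 = tau.
  apply: (mulIf b0); rewrite mulrBl mulVf //; apply/eqP; rewrite -subr_eq0; apply/eqP.
  transitivity ((Num.sqrt (tau ^+ 2 + 4) ^+ 2 - (tau ^+ 2 + 4)) / 4).
    by rewrite /b; field.
  by rewrite sq subrr mul0r.
exists b, t; split=> //; apply: eq_on_words => u.
have bern v : bernoulli b (ncword v) = fock 1 T (fun _ _ => 1 + -1) v [::].
  rewrite (@bernoulli_fock b T) ?bE //; apply: eq_fock => // i j; by rewrite subrr.
rewrite phiE (belinschi_nica_fock t0 bern); apply: eq_fock => // i j.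
by rewrite !ord1 CE addrCA subrr addr0.
Qed.

End OneVariable.

Unset Implicit Arguments.

Theorem proposition8 (R : realType) :
  (forall d : nat, (0 < d)%N ->
     [/\ (forall (phi : {scalar ncpoly R d}) (t : R),
            in_meixner_class phi -> 0 < t ->
            in_meixner_class_upto_dilation (boolean_power t phi)),
         (forall (phi : {scalar ncpoly R d}) (t : R),
            in_meixner_class phi -> 0 < t ->
            1 <= t \/ is_state (free_power t phi) ->
            in_meixner_class_upto_dilation (free_power t phi)),
         (forall (phi : {scalar ncpoly R d}) (t : R),
            in_meixner_class phi -> 0 <= t ->
            in_meixner_class (belinschi_nica t phi))
       & (forall (C : 'M[R[i]]_(d * d)) (T : 'I_d -> 'M[R[i]]_d) (t : R),
            meixner_data C T -> 0 <= t ->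
            belinschi_nica t (free_meixner C T)
              =1 free_meixner (t%:C%C%:M + C) T)]) /\
  (forall phi : {scalar ncpoly R 1},
     in_meixner_class phi ->
     exists b t : R,
       [/\ b != 0, 0 <= t & phi =1 belinschi_nica t (bernoulli b)]).
Proof.
split=> [d _|phi]; last exact: meixner_from_bernoulli.
split=> [phi t|phi t|phi t|C T t _].
- exact: boolean_power_meixner.
- exact: free_power_meixner.
- exact: belinschi_nica_meixner.
- exact: belinschi_nica_free_meixner.
Qed.
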